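(* Let $Q$ be acyclic of affine type, and let $(v,w)$ be a banded pair with $x_v-x_w=\pm\partial(x)$ as linear forms in $x\in\mathbb{Z}^{Q_0}$. Then $\pi_{vw}$ fails to fill: the diagonal $\{c_v-c_w=0\}$ is the defect-zero locus, and it carries only the finite regular part of $C(Q)$. For a source-sink orientation of the $(n+1)$-cycle (type $\widetilde A_n$) with source $s$ and sink $t$, the defect is the coordinate difference $\partial(x)=x_s-x_t$, so the hypothesis holds precisely for the source-sink pair $(s,t)$; there $\partial$ takes only the values $-1,0,+1$ on $C(Q)$, the band is $\{|c_s-c_t|\le1\}$, the three band lines $c_s-c_t=-1,0,+1$ are exactly the preprojective, regular, and preinjective strata of $C(Q)$, and the diagonal is the unique non-filled line.
   Context: All quivers are finite, connected, and without loops or 2-cycles. $C(Q)\subset\mathbb{Z}^{Q_0}$ denotes the set of all $c$-vectors of the cluster algebra with principal coefficients at the seed associated with the acyclic quiver $Q$; it is known that $C(Q)=\{\pm\beta:\beta\text{ a real Schur root of }Q\}$, the real Schur roots being the dimension vectors of the exceptional (rigid, indecomposable) $kQ$-modules, $k$ algebraically closed. $Q$ is of affine type if its underlying graph is a Euclidean (extended Dynkin) diagram; $\delta$ denotes the null root (positive primitive generator of the radical of the Tits form $q(x)=\sum_i x_i^2-\sum_{i\to j}x_ix_j$). The defect is $\partial(x)=\langle\delta,x\rangle$ with Euler form $\langle x,y\rangle=\sum_i x_iy_i-\sum_{i\to j}x_iy_j$; an indecomposable module is preprojective, regular or preinjective according as the defect of its dimension vector is $<0$, $=0$ or $>0$,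 and correspondingly the preprojective, regular and preinjective strata of $C(Q)$ are the sets of $c\in C(Q)$ with $\partial(c)<0$, $=0$, $>0$. A pair $(v,w)$ of distinct vertices is banded if $\delta_v=\delta_w$ (equivalently $b_{vw}=\sup_{c\in C(Q)}|c_v-c_w|<\infty$). $\pi_{vw}(c)=(c_v,c_w)$; the band is $\{(x,y)\in\mathbb{Z}^2:|x-y|\le b_{vw}\}$, the band lines are $\{c_v-c_w=d\}$ for integers $|d|\le b_{vw}$, a line is filled if $\pi_{vw}(C(Q))$ contains every integer point of it, and $\pi_{vw}$ fills if every band line is filled. A source-sink orientation of the $(n+1)$-cycle is an acyclic orientation with a unique source $s$ and a unique sink $t$. *)

(* Defs.v *)
From mathcomp Require Import all_boot all_order all_algebra.
From mathcomp Require Import all_classical.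

Set Implicit Arguments.
Unset Strict Implicit.
Unset Printing Implicit Defensive.

Import Order.TTheory GRing.Theory Num.Theory.

Local Open Scope ring_scope.
Local Open Scope classical_set_scope.

(* [Q i j] is the number of arrows i -> j. *)
Record quiver (T : finType) := Quiver {
  arrows :> T -> T -> nat;
  no_loops : forall i, arrows i i = 0%N;
  no_2cycles : forall i j, arrows i j = 0%N \/ arrows j i = 0%N;
  connected_quiver :
    forall i j, connect [rel a b | (0 < arrows a b + arrows b a)%N] i j
}.

Definition acyclic_quiver (T : finType) (Q : quiver T) : Prop :=
  forall p : seq T, cycle [rel a b | (0 < Q a b)%N] p -> p = [::].

Definition is_source (T : finType) (Q : quiver T) (i : T) : Prop :=
  forall j, Q j i = 0%N.

Definition is_sink (T : finType) (Q : quiver T) (i : T) : Prop :=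
  forall j, Q i j = 0%N.

(* Loop-free multigraphs on {0, .., N - 1} are given by their list of edges,
   each edge being listed once, in either direction. *)
Definition edge_mult (E : seq (nat * nat)) (a b : nat) : nat :=
  (count_mem (a, b) E + count_mem (b, a) E)%N.

Definition underlying_graph (T : finType) (Q : quiver T)
    (N : nat) (E : seq (nat * nat)) : Prop :=
  exists f : T -> 'I_N, bijective f /\
    forall i j, (Q i j + Q j i)%N = edge_mult E (f i) (f j).

(* The (n+1)-cycle; for n = 1 this is a double edge. *)
Definition cycle_edges (n : nat) : seq (nat * nat) :=
  [seq (i, (i.+1 %% n.+1)%N) | i <- iota 0 n.+1].

(* The path 2 - 3 - .. - (n-2), with leaves 0, 1 attached to 2 and leaves
   n-1, n attached to n-2. *)
Definition Dtilde_edges (n : nat) : seq (nat * nat) :=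
  [:: (0, 2); (1, 2)]%N ++ [seq (i, i.+1) | i <- iota 2 (n - 4)]
  ++ [:: (n - 2, n - 1); (n - 2, n)]%N.

(* Stars centred at 0 with arms of lengths 2,2,2 and 1,3,3 and 1,2,5. *)
Definition Etilde6_edges : seq (nat * nat) :=
  [:: (0, 1); (1, 2); (0, 3); (3, 4); (0, 5); (5, 6)]%N.
Definition Etilde7_edges : seq (nat * nat) :=
  [:: (0, 1); (0, 2); (2, 3); (3, 4); (0, 5); (5, 6); (6, 7)]%N.
Definition Etilde8_edges : seq (nat * nat) :=
  [:: (0, 1); (0, 2); (2, 3); (0, 4); (4, 5); (5, 6); (6, 7); (7, 8)]%N.

Inductive euclidean : nat -> seq (nat * nat) -> Prop :=
| Euclidean_A n of (1 <= n)%N : euclidean n.+1 (cycle_edges n)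
| Euclidean_D n of (4 <= n)%N : euclidean n.+1 (Dtilde_edges n)
| Euclidean_E6 : euclidean 7 Etilde6_edges
| Euclidean_E7 : euclidean 8 Etilde7_edges
| Euclidean_E8 : euclidean 9 Etilde8_edges.

Definition affine_type (T : finType) (Q : quiver T) : Prop :=
  exists N E, euclidean N E /\ underlying_graph Q N E.

Definition source_sink_cycle (n : nat) (T : finType) (Q : quiver T) (s t : T)
    : Prop :=
  [/\ underlying_graph Q n.+1 (cycle_edges n), acyclic_quiver Q,
      forall i, is_source Q i <-> i = s &
      forall i, is_sink Q i <-> i = t].

Definition euler_form (T : finType) (Q : quiver T) (x y : {ffun T -> int})
    : int :=
  \sum_i x i * y i - \sum_i \sum_j (Q i j)%:Z * (x i * y j).

Definition tits_form (T : finType) (Q : quiver T) (x : {ffun T -> int}) : int :=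
  \sum_i x i ^+ 2 - \sum_i \sum_j (Q i j)%:Z * (x i * x j).

(* The radical of the symmetric bilinear form q(x + y) - q(x) - q(y). *)
Definition tits_radical (T : finType) (Q : quiver T) : set {ffun T -> int} :=
  [set x | forall y, tits_form Q (x + y) = tits_form Q x + tits_form Q y].

Definition is_null_root (T : finType) (Q : quiver T) (delta : {ffun T -> int})
    : Prop :=
  [/\ forall i, 0 < delta i,
      forall d : nat, (forall i, exists k : int, delta i = d%:Z * k) ->
        d = 1%N &
      tits_radical Q = [set x | exists k : int, x = delta *~ k]].

Definition defect (T : finType) (Q : quiver T) (delta x : {ffun T -> int})
    : int := euler_form Q delta x.

(* Extended exchange matrices with principal coefficients: the rows [inl i]
   are the mutable ones, the rows [inr i] the frozen ones. *)
Definition ext_matrix (T : finType) := T + T -> T -> int.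

Definition initial_matrix (T : finType) (Q : quiver T) : ext_matrix T :=
  fun r j => match r with
  | inl i => (Q i j)%:Z - (Q j i)%:Z
  | inr i => if i == j then 1 else 0
  end.

Definition pos_part (x : int) : int := Num.max x 0.

(* Fomin-Zelevinsky matrix mutation in direction k. *)
Definition mutate (T : finType) (k : T) (B : ext_matrix T) : ext_matrix T :=
  fun r j =>
    if (r == inl k) || (j == k) then - B r j
    else B r j + pos_part (B r k) * pos_part (B (inl k) j)
               - pos_part (- B r k) * pos_part (- B (inl k) j).

Definition cvector (T : finType) (B : ext_matrix T) (j : T) : {ffun T -> int} :=
  [ffun i => B (inr i) j].

Definition cvectors (T : finType) (Q : quiver T) : set {ffun T -> int} :=
  [set c | exists (ks : seq T) (j : T),
     c = cvector (foldr (@mutate T) (initial_matrix Q) ks) j].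

Definition preprojective_stratum (T : finType) (Q : quiver T)
    (delta : {ffun T -> int}) : set {ffun T -> int} :=
  [set c | cvectors Q c /\ defect Q delta c < 0].

Definition regular_stratum (T : finType) (Q : quiver T)
    (delta : {ffun T -> int}) : set {ffun T -> int} :=
  [set c | cvectors Q c /\ defect Q delta c = 0].

Definition preinjective_stratum (T : finType) (Q : quiver T)
    (delta : {ffun T -> int}) : set {ffun T -> int} :=
  [set c | cvectors Q c /\ 0 < defect Q delta c].

Definition banded (T : finType) (delta : {ffun T -> int}) (v w : T) : Prop :=
  v <> w /\ delta v = delta w.

Definition difference_is_defect (T : finType) (Q : quiver T)
    (delta : {ffun T -> int}) (v w : T) : Prop :=
  (forall x : {ffun T -> int}, x v - x w = defect Q delta x) \/
  (forall x : {ffun T -> int}, x v - x w = - defect Q delta x).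

Definition proj (T : finType) (v w : T) (c : {ffun T -> int}) : int * int :=
  (c v, c w).

Definition width_bound (T : finType) (Q : quiver T) (v w : T) (b : int)
    : Prop :=
  forall c, cvectors Q c -> `|c v - c w| <= b.

(* b_vw = b, where b_vw is the supremum of |c_v - c_w| over all c-vectors. *)
Definition is_width (T : finType) (Q : quiver T) (v w : T) (b : int) : Prop :=
  width_bound Q v w b /\ forall b', width_bound Q v w b' -> b <= b'.

(* |x - y| <= b_vw, where b_vw may be infinite. *)
Definition band (T : finType) (Q : quiver T) (v w : T) : set (int * int) :=
  [set p | forall b, width_bound Q v w b -> `|p.1 - p.2| <= b].

(* |d| <= b_vw, where b_vw may be infinite. *)
Definition band_line (T : finType) (Q : quiver T) (v w : T) (d : int) : Prop :=
  forall b, width_bound Q v w b -> `|d| <= b.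

Definition filled (T : finType) (Q : quiver T) (v w : T) (d : int) : Prop :=
  [set p : int * int | p.1 - p.2 = d] `<=` proj v w @` cvectors Q.

Definition fills (T : finType) (Q : quiver T) (v w : T) : Prop :=
  forall d, band_line Q v w d -> filled Q v w d.

(* Main.v *)
(** A pair as in the first part exists only when [Q] is a source-sink cycle:
    testing [x_v - x_w = +-defect x] on unit vectors shows that every leaf of the
    underlying tree would be [v] or [w], which excludes the types D and E, and on
    a cycle it makes [v], [w] the only source and the only sink.

    On a source-sink cycle let [inc x a] be the increment of [x] along the arrow
    [a].  Then [2 q x] is the sum of the [inc x a ^ 2], so a real root changes
    along exactly two arrows, by one: it is an arc plus a multiple of the null
    root, and it is sign-coherent.  Each c-vector of a seed is thus an edge
    joining two arrows, and at every arrow at most three c-vectors meet, in three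
    slots: decrement of a positive vector, increment, decrement of a negative
    vector.  The Euler form of two c-vectors is a sum of contributions of the
    arrows where they meet, non-zero only from an earlier to a later slot, and
    the exchange matrix is its antisymmetrisation (the arrows play the role of
    the triangles of a triangulated annulus).  These properties are preserved by
    mutation.  Hence all c-vectors are real roots, which bounds the defect, and
    comparing a regular c-vector with a non-regular one of the same seed forces
    its entries to lie in {-1, 0, 1}, so the diagonal is not filled.

    Conversely, contracting both paths from [s] to [t] by mutations leads to a
    seed with a double arrow [s => t]; mutating at [s] and [t] alternately then
    yields c-vectors projecting to all points of the lines of slope one at
    distance one from the diagonal. *)

Require Import Defs.
From mathcomp Require Import all_boot all_order all_algebra.
From mathcomp Require Import all_classical.
From mathcomp Require Import zify ring.

Set Implicit Arguments.
Unset Strict Implicit.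
Unset Printing Implicit Defensive.

Import Order.TTheory GRing.Theory Num.Theory.

Local Open Scope ring_scope.

(** * Slots at an arrow *)

(* [d] is the increment of a vector at an arrow and [p] tells whether the vector
   is nonnegative; slot [0] means that the vector does not change there. *)
Definition slot (d : int) (p : bool) : nat :=
  if d == 1 then 2 else if d == -1 then (if p then 1 else 3) else 0.

(* The contribution of an arrow to the Euler form of two vectors of a frame. *)
Definition eloc (d : int) (p : bool) (d' : int) (p' : bool) : int :=
  if (0 < slot d p < slot d' p')%N then d * d' else 0.

Definition slot_neq (d : int) (p : bool) (d' : int) (p' : bool) : bool :=
  [|| d == 0, d' == 0 | slot d p != slot d' p'].

Lemma slot_neq_sym d p d' p' : slot_neq d p d' p' = slot_neq d' p' d p.
Proof. by rewrite /slot_neq orbCA [slot d p == _]eq_sym. Qed.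

Lemma eloc0l p d' p' : eloc 0 p d' p' = 0. Proof. by []. Qed.

Lemma eloc0r d p p' : eloc d p 0 p' = 0.
Proof. by rewrite /eloc [slot 0 _]/= ltn0 andbF. Qed.

(** For a fixed sign only two slots occur, and they carry opposite increments. *)
Lemma eloc_same_sign d d' p : eloc d p d' p <= 0.
Proof.
rewrite /eloc /slot.
case: (d =P 1) => [->|_]; last case: (d =P -1) => [->|_] //;
  by case: (d' =P 1) => [->|_]; last case: (d' =P -1) => [->|_]; case: p.
Qed.

Lemma eloc_neg_pos d d' : eloc d false d' true = 0.
Proof.
rewrite /eloc /slot.
by case: (d =P 1); case: (d =P -1); case: (d' =P 1); case: (d' =P -1).
Qed.

Lemma eloc_anti d p d' p' : eloc d p d' p' = 0 \/ eloc d' p' d p = 0.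
Proof. by rewrite /eloc; case: ifP; case: ifP; lia. Qed.

Lemma slot_eq d p p' : (d = -1 -> p = p') -> slot d p = slot d p'.
Proof. by rewrite /slot; case: (d =P -1) => // -> ->. Qed.

Lemma eloc_eq d p q d' p' q' : (d = -1 -> p = q) -> (d' = -1 -> p' = q') ->
  eloc d p d' p' = eloc d q d' q'.
Proof. by move=> h h'; rewrite /eloc (slot_eq h) (slot_eq h'). Qed.

(** The multiplicity [mult] read off from the two arrows alone, by [mult_local]. *)
Definition lmult (ka kb : int) (pk : bool) (ia ib : int) (p : bool) : int :=
  let w := eloc ia p ka pk + eloc ib p kb pk
           - (eloc ka pk ia p + eloc kb pk ib p) in
  Num.max 0 (if pk then w else - w).

(* Mutation at [k] only affects the two arrows where the vector [k] changes.
   Here [ka], [kb] are its increments there and [pk] its sign; [ia], [ib] are the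
   increments of another vector, and [p], [p'] its signs before and after.  The
   conjuncts are what geometry says about such data; that slots and Euler form
   are then as they should be is a finite verification. *)
Definition admissible (ka kb : int) (pk : bool) (ia ib : int) (p p' : bool) :=
  let m := lmult ka kb pk ia ib p in
  [&& slot_neq ia p ka pk, slot_neq ib p kb pk,
      (ia != 0) && (ib != 0) ==> (ia * ib == ka * kb),
      ~~ [&& p == pk, ia == - ka, ib == - kb & ka == - kb],
      (m == 0) || (p == pk) ==> (p' == p) &
      (m != 0) && ((ka == -1) && (ia + m * ka != 0)
                   || (kb == -1) && (ib + m * kb != 0)) ==> (p' == pk)].

(** The first conjunct keeps the Tits form equal to one. The right-hand sides of the last two are
    forced by bilinearity and [ef (c k) (c k) = 1]. *)
Definition mutation_ok (ka kb : int) (pk : bool) (ia ib : int) (p p' : bool) :=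
  let m := lmult ka kb pk ia ib p in
  let ia' := ia + m * ka in let ib' := ib + m * kb in
  [&& (m != 0) ==> (eloc ia p ka pk + eloc ib p kb pk
                    + (eloc ka pk ia p + eloc kb pk ib p) == - m),
      slot_neq ia' p' (- ka) (~~ pk), slot_neq ib' p' (- kb) (~~ pk),
      eloc ia' p' (- ka) (~~ pk) + eloc ib' p' (- kb) (~~ pk)
        == - (eloc ia p ka pk + eloc ib p kb pk + m) &
      eloc (- ka) (~~ pk) ia' p' + eloc (- kb) (~~ pk) ib' p'
        == - (eloc ka pk ia p + eloc kb pk ib p + m)].

(** The last conjunct expands the form of [c i + m * c k] and [c j + n * c k], restricted to the two
    arrows. *)
Definition mutation_ok2 (ka kb : int) (pk : bool)
    (ia ib : int) (p p' : bool) (ja jb : int) (q q' : bool) :=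
  let m := lmult ka kb pk ia ib p in
  let n := lmult ka kb pk ja jb q in
  let ia' := ia + m * ka in let ib' := ib + m * kb in
  let ja' := ja + n * ka in let jb' := jb + n * kb in
  [&& slot_neq ia' p' ja' q', slot_neq ib' p' jb' q' &
      eloc ia' p' ja' q' + eloc ib' p' jb' q'
      == eloc ia p ja q + eloc ib p jb q
         + n * (eloc ia p ka pk + eloc ib p kb pk)
         + m * (eloc ka pk ja q + eloc kb pk jb q) + m * n].

Definition units : seq int := [:: -1; 1].
Definition signs : seq int := [:: -1; 0; 1].
Definition bools : seq bool := [:: true; false].

Lemma mem_bools b : b \in bools. Proof. by case: b. Qed.

Lemma mem_units d : `|d| = 1 -> d \in units.
Proof. by move=> h; have [->|->] : d = 1 \/ d = -1 by lia. Qed.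

Lemma mem_signs d : `|d| <= 1 -> d \in signs.
Proof. by move=> h; have [->|[->|->]] : d = 1 \/ d = -1 \/ d = 0 by lia. Qed.

Lemma admissible_ok ka kb pk ia ib p p' :
  `|ka| = 1 -> `|kb| = 1 -> `|ia| <= 1 -> `|ib| <= 1 ->
  admissible ka kb pk ia ib p p' -> mutation_ok ka kb pk ia ib p p'.
Proof.
have : all (fun ka => all (fun kb => all (fun pk => all (fun ia => all (fun ib =>
    all (fun p => all (fun p' => admissible ka kb pk ia ib p p' ==>
      mutation_ok ka kb pk ia ib p p') bools) bools) signs) signs) bools) units) units
  by vm_compute.
move=> h /mem_units /(allP h) {}h /mem_units /(allP h) {}h.
have {}h := allP h _ (mem_bools pk).
move=> /mem_signs /(allP h) {}h /mem_signs /(allP h) {}h.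
have {}h := allP h _ (mem_bools p).
have {}h := allP h _ (mem_bools p').
exact: (implyP h).
Qed.

Lemma admissible_ok2 ka kb pk ia ib p p' ja jb q q' :
  `|ka| = 1 -> `|kb| = 1 -> `|ia| <= 1 -> `|ib| <= 1 -> `|ja| <= 1 -> `|jb| <= 1 ->
  admissible ka kb pk ia ib p p' -> admissible ka kb pk ja jb q q' ->
  slot_neq ia p ja q -> slot_neq ib p jb q ->
  ((ia != 0) && (ib != 0) && (ja != 0) && (jb != 0) ==> (ia * ib == ja * jb)) ->
  mutation_ok2 ka kb pk ia ib p p' ja jb q q'.
Proof.
have : all (fun ka => all (fun kb => all (fun pk => all (fun ia => all (fun ib =>
    all (fun p => all (fun p' => admissible ka kb pk ia ib p p' ==>
    all (fun ja => all (fun jb => all (fun q => all (fun q' =>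
      [&& admissible ka kb pk ja jb q q', slot_neq ia p ja q, slot_neq ib p jb q
        & (ia != 0) && (ib != 0) && (ja != 0) && (jb != 0) ==> (ia * ib == ja * jb)]
      ==> mutation_ok2 ka kb pk ia ib p p' ja jb q q')
    bools) bools) signs) signs) bools) bools) signs) signs) bools) units) units
  by vm_compute.
move=> h /mem_units /(allP h) {}h /mem_units /(allP h) {}h.
have {}h := allP h _ (mem_bools pk).
move=> /mem_signs /(allP h) {}h /mem_signs /(allP h) {}h.
have {}h := allP h _ (mem_bools p).
have {}h := allP h _ (mem_bools p').
move=> hja hjb hi hj s1 s2 hs; move/implyP/(_ hi): h => h.
have {}h := allP h _ (mem_signs hja); have {}h := allP h _ (mem_signs hjb).
have {}h := allP h _ (mem_bools q); have {}h := allP h _ (mem_bools q').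
by apply: (implyP h); rewrite hj s1 s2 hs.
Qed.

(** * Real roots of a source-sink cycle *)

Lemma sum_split_two (A : finType) (F : A -> int) (a b : A) : a != b ->
  \sum_c F c = F a + F b + \sum_(c | (c != a) && (c != b)) F c.
Proof. by move=> ab; rewrite (bigD1 a) //= (bigD1 b) 1?eq_sym //= addrA. Qed.

Lemma sum_two (A : finType) (F : A -> int) (a b : A) : a != b ->
  (forall c, c != a -> c != b -> F c = 0) -> \sum_c F c = F a + F b.
Proof.
move=> ab F0; rewrite (sum_split_two F ab) big1 ?addr0 // => c /andP[ca cb].
exact: F0.
Qed.

Section SourceSink.

Variables (T A : finType) (tl hd : A -> T) (s t : T).

(** Degrees in summed form: every vertex is the tail of one arrow, except two for [s] and none for
    [t], and dually for heads. [conn] expresses connectedness. *)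
Hypothesis sum_tl :
  forall f : T -> int, \sum_a f (tl a) = \sum_i f i + f s - f t.
Hypothesis sum_hd :
  forall f : T -> int, \sum_a f (hd a) = \sum_i f i - f s + f t.
Hypothesis conn :
  forall x : T -> int, (forall a, x (tl a) = x (hd a)) -> forall i j, x i = x j.

Implicit Types (x y z : T -> int) (a b d : A).

Definition inc x a : int := x (hd a) - x (tl a).

Definition ef x y : int := \sum_i x i * y i - \sum_a x (tl a) * y (hd a).

Lemma sum_inc x : \sum_a inc x a = - 2 * (x s - x t).
Proof. rewrite sumrB sum_hd sum_tl; ring. Qed.

(** Partial summation: only the arrows where one chosen argument changes remain, together with a
    boundary term at [s] and [t]. *)
Lemma ef_tl x y :
  ef x y = x t * y t - x s * y s - \sum_a x (tl a) * inc y a.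
Proof.
under eq_bigr do rewrite mulrBr.
rewrite sumrB (sum_tl (fun i => x i * y i)) /ef; ring.
Qed.

Lemma ef_hd x y :
  ef x y = x s * y s - x t * y t + \sum_a inc x a * y (hd a).
Proof.
under [X in _ = _ + X]eq_bigr do rewrite mulrBl.
rewrite sumrB (sum_hd (fun i => x i * y i)) /ef; ring.
Qed.

(** The boundary terms of the two partial summations cancel. For [x = y] this writes twice the Tits
    form as a sum of squares. *)
Lemma ef_sym x y : ef x y + ef y x = \sum_a inc x a * inc y a.
Proof.
rewrite ef_hd (ef_tl y x).
under [X in _ = X]eq_bigr do rewrite mulrBr [_ * y (tl _)]mulrC.
rewrite sumrB; ring.
Qed.

Lemma ef_addl x y z m : ef (fun i => x i + m * y i) z = ef x z + m * ef y z.
Proof.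
rewrite /ef; under eq_bigr do rewrite mulrDl -mulrA.
under [X in _ - X]eq_bigr do rewrite mulrDl -mulrA.
rewrite !big_split /= -!mulr_sumr; ring.
Qed.

Lemma ef_addr x y z m : ef z (fun i => x i + m * y i) = ef z x + m * ef z y.
Proof.
rewrite /ef; under eq_bigr do rewrite mulrDr mulrCA.
under [X in _ - X]eq_bigr do rewrite mulrDr mulrCA.
rewrite !big_split /= -!mulr_sumr; ring.
Qed.

Lemma eq_ef x x' y y' : x =1 x' -> y =1 y' -> ef x y = ef x' y'.
Proof.
move=> ex ey; rewrite /ef; congr (_ - _).
  by apply: eq_bigr => i _; rewrite ex ey.
by apply: eq_bigr => a _; rewrite ex ey.
Qed.

Lemma ef_oppl x y : ef (fun i => - x i) y = - ef x y.
Proof.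
rewrite /ef; under eq_bigr do rewrite mulNr.
under [X in _ - X]eq_bigr do rewrite mulNr.
rewrite !sumrN; ring.
Qed.

Lemma ef_oppr x y : ef x (fun i => - y i) = - ef x y.
Proof.
rewrite /ef; under eq_bigr do rewrite mulrN.
under [X in _ - X]eq_bigr do rewrite mulrN.
rewrite !sumrN; ring.
Qed.

(** Constant functions are the multiples of the null root, so pairing with them gives multiples of
    the defect. *)
Lemma ef_constr x k : ef x (fun=> k) = k * (x t - x s).
Proof.
rewrite ef_tl big1 => [|a _]; last by rewrite /inc subrr mulr0.
ring.
Qed.

Lemma ef_constl x k : ef (fun=> k) x = k * (x s - x t).
Proof.
rewrite ef_hd big1 => [|a _]; last by rewrite /inc subrr mul0r.
ring.
Qed.

(** The sum of the absolute values has the parity of the sum of the increments, hence is even;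
    connectedness makes it non-zero. *)
Lemma nonconst_sum_inc x i j : x i != x j -> 2 <= \sum_a `|inc x a|.
Proof.
move=> xij.
have e : \sum_a `|inc x a| = \sum_a inc x a + 2 * \sum_a Num.max (- inc x a) 0.
  rewrite mulr_sumr -big_split /=; apply: eq_bigr => a _.
  case: (leP (- inc x a) 0) => ?; lia.
have ne : \sum_a `|inc x a| != 0.
  apply: contra_neq xij => /psumr_eq0P h.
  apply: conn => a; have := h (fun a _ => normr_ge0 _) a isT.
  rewrite /inc; lia.
have ge : 0 <= \sum_a `|inc x a| by exact: sumr_ge0.
move: e ne ge; rewrite sum_inc; lia.
Qed.

(** By [ef_sym] this says that the Tits form takes the value one. *)
Definition real_root x := \sum_a inc x a ^+ 2 = 2.

Lemma root_inc x a : real_root x -> `|inc x a| <= 1.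
Proof.
rewrite /real_root (bigD1 a) //= => h.
have : 0 <= \sum_(b | b != a) inc x b ^+ 2 by apply: sumr_ge0 => b _; exact: sqr_ge0.
move: h; set S := \sum_(b | _) _; nia.
Qed.

Lemma root_sum_norm x : real_root x -> \sum_a `|inc x a| = 2.
Proof.
move=> rx; rewrite -{}[RHS](rx); apply: eq_bigr => a _.
have := root_inc a rx; nia.
Qed.

Lemma root_range x i j : real_root x -> x i <= x j + 1.
Proof.
move=> rx; rewrite leNgt; apply/negP => xij.
(* Indicators of two successive level sets: both are non-constant, so together they vary by at least
   4, while [x] varies only by 2. *)
pose y k := if x j + 1 <= x k then 1 else 0 : int.
pose z k := if x j + 2 <= x k then 1 else 0 : int.
have yij : y i != y j by rewrite /y; case: ifP; case: ifP; lia.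
have zij : z i != z j by rewrite /z; case: ifP; case: ifP; lia.
have := lerD (nonconst_sum_inc yij) (nonconst_sum_inc zij).
rewrite -big_split /= leNgt => /negP; apply.
apply: (@le_lt_trans _ _ (\sum_a `|inc x a|)); last by rewrite root_sum_norm.
apply: ler_sum => a _; rewrite /inc /y /z.
do 4 case: ifP; lia.
Qed.

Lemma root_values x : real_root x -> exists m, forall i, x i = m \/ x i = m + 1.
Proof.
move=> rx.
have [[a xa]|] := pselect (exists a, x (tl a) <> x (hd a)).
  exists (Num.min (x (tl a)) (x (hd a))) => i.
  have := root_range (tl a) (hd a) rx; have := root_range (hd a) (tl a) rx.
  have := root_range i (hd a) rx; have := root_range i (tl a) rx.
  have := root_range (hd a) i rx; have := root_range (tl a) i rx.
  case: leP; lia.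
move=> h; exists (x s) => i; left; apply: conn => a.
by apply: contra_notP h => ?; exists a.
Qed.

Variant root_support_spec x : Prop :=
  RootSupport a b of a != b & `|inc x a| = 1 & `|inc x b| = 1
    & forall c, c != a -> c != b -> inc x c = 0.

Lemma root_supportP x : real_root x -> root_support_spec x.
Proof.
move=> rx; have S2 := root_sum_norm rx.
have [a xa|x0] := pickP (fun a => inc x a != 0); last first.
  move: S2; rewrite big1 // => a _; apply/eqP; rewrite normr_eq0.
  by have /negbFE := x0 a.
have na : `|inc x a| = 1 by have := root_inc a rx; lia.
move: S2; rewrite (bigD1 a) //= na => S1.
have [b /andP[ba xb]|x0] := pickP (fun b => (b != a) && (inc x b != 0)); last first.
  move: S1; rewrite big1 // => b ba; apply/eqP; rewrite normr_eq0.
  by have := x0 b; rewrite ba => /negbFE.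
have nb : `|inc x b| = 1 by have := root_inc b rx; lia.
have {S1} S0 : \sum_(c | (c != a) && (c != b)) `|inc x c| = 0.
  by move: S1; rewrite (bigD1 b) //= nb; set S := \sum_(c | _) _; lia.
exists a b => //; first by rewrite eq_sym.
move=> c ca cb; apply/eqP; rewrite -normr_eq0.
by rewrite (psumr_eq0P _ S0) // ca cb.
Qed.

Lemma root_not_const x : real_root x -> exists i j, x i <> x j.
Proof.
case/root_supportP => a b _ xa _ _; exists (hd a), (tl a).
by move: xa; rewrite /inc; lia.
Qed.

Definition nonneg x := [forall i, 0 <= x i].

Lemma nonnegP x : reflect (forall i, 0 <= x i) (nonneg x).
Proof. exact: forallP. Qed.

(** Sign-coherence: a negative entry is at most -1, and no other entry exceeds it by more than
    one. *)
Lemma root_neg x i : real_root x -> ~~ nonneg x -> x i <= 0.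
Proof.
move=> rx /forallPn[j]; rewrite -ltNge => xj.
by have := root_range i j rx; lia.
Qed.

Lemma root_negN x : real_root x -> nonneg (fun i => - x i) = ~~ nonneg x.
Proof.
move=> rx; apply/nonnegP/idP => [h|h i]; last by have := root_neg i rx h; lia.
apply/nonnegP => h'; have [i [j]] := root_not_const rx.
by have := h i; have := h j; have := h' i; have := h' j; lia.
Qed.

Lemma incN x a : inc (fun i => - x i) a = - inc x a.
Proof. by rewrite /inc; ring. Qed.

Lemma rootN x : real_root x -> real_root (fun i => - x i).
Proof.
by rewrite /real_root => <-; apply: eq_bigr => a _; rewrite incN sqrrN.
Qed.

Lemma ef_root x : real_root x -> ef x x = 1.
Proof.
move=> rx; have := ef_sym x x.
under eq_bigr do rewrite -expr2.
rewrite rx; lia.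
Qed.

Lemma root_other x a b c : real_root x -> a != b -> inc x a != 0 -> inc x b != 0 ->
  c != a -> c != b -> inc x c = 0.
Proof.
move=> rx ab xa xb ca cb; apply/eqP/negP => xc.
have := root_sum_norm rx.
rewrite (bigD1 a) //= (bigD1 b) 1?eq_sym //= (bigD1 c) ?ca ?cb //=.
have : 0 <= \sum_(i | (i != a) && (i != b) && (i != c)) `|inc x i| by apply: sumr_ge0.
set S := \sum_(i | _) _; lia.
Qed.

Lemma root_defect x a b : real_root x -> a != b -> inc x a != 0 -> inc x b != 0 ->
  inc x a + inc x b = -2 * (x s - x t).
Proof.
move=> rx ab xa xb; rewrite -sum_inc (sum_two ab) // => c ca cb.
exact: root_other xb ca cb.
Qed.

(** * Pairs of real roots *)

Lemma inc_values x m a : (forall i, x i = m \/ x i = m + 1) -> inc x a != 0 ->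
  [/\ x (hd a) = m + 1, x (tl a) = m & inc x a = 1] \/
  [/\ x (hd a) = m, x (tl a) = m + 1 & inc x a = -1].
Proof.
move=> xm; rewrite /inc.
case: (xm (hd a)) => ->; case: (xm (tl a)) => ->; rewrite ?subrr ?eqxx // => _.
  by right; split=> //; ring.
by left; split=> //; ring.
Qed.

(* For 0/1-valued [x] and [y], the increments of the product [x * y] at [a] and
   [b] are odd when [x] and [y] change in the same sense there and vanish
   otherwise, while the sum of all increments of a function is even. *)
Lemma root_shared_support x y a b : real_root x -> real_root y -> a != b ->
  inc x a != 0 -> inc x b != 0 -> inc y a != 0 -> inc y b != 0 ->
  inc x a * inc x b = inc y a * inc y b.
Proof.
move=> rx ry ab xa xb ya yb.
have [m xm] := root_values rx; have [n yn] := root_values ry.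
have := sum_inc (fun i => (x i - m) * (y i - n)).
rewrite (sum_two ab) => [|c ca cb]; last first.
  have := root_other rx ab xa xb ca cb; have := root_other ry ab ya yb ca cb.
  by rewrite /inc => /subr0_eq -> /subr0_eq ->; rewrite subrr.
set d := _ - _; move: d => d; rewrite {1 2}/inc.
case: (inc_values xm xa) => -[-> -> ->]; case: (inc_values xm xb) => -[-> -> ->];
case: (inc_values yn ya) => -[-> -> ->]; case: (inc_values yn yb) => -[-> -> ->]; lia.
Qed.

(** The increments add up to zero, so if none is negative they all vanish. The contradictions below
    come from products violating this. *)
Lemma sum_inc_pos x a : x s = x t -> (forall c, 0 <= inc x c) -> inc x a <= 0.
Proof.
move=> st x0; have := sum_inc x; rewrite st subrr mulr0.
move=> /psumr_eq0P h; rewrite h // => c _; exact: x0.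
Qed.

(* [c] leads from the arc of [x] to that of [y], which contributes [-1] to
   [ef x y]; the arcs overlapping at their other ends can reverse the roles only
   if [x + y] is regular and has an entry [>= 2].  In the mixed cases the
   contradiction is a product of shifts of [x] and [y] with equal values at [s]
   and [t] whose increments are nonnegative and not all zero. *)
Lemma adjacent_roots_ef x y c : real_root x -> real_root y -> nonneg x -> nonneg y ->
  inc x c = -1 -> inc y c = 1 -> ef x y = 0 -> ef y x = -1 ->
  (x s + y s = x t + y t -> forall i, x i + y i <= 1) -> False.
Proof.
move=> rx ry /nonnegP x0 /nonnegP y0 xc yc exy eyx bnd.
have other z : real_root z -> inc z c != 0 -> exists2 a, a != c & inc z a != 0.
  move=> rz zc; case: (root_supportP rz) => a b ab za zb z0.
  have [ca|ca] := eqVneq c a.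
    by exists b; [rewrite ca eq_sym|lia].
  by exists a; [rewrite eq_sym|lia].
have [a ac xa] : exists2 a, a != c & inc x a != 0 by apply: other => //; rewrite xc.
have [b bc yb] : exists2 b, b != c & inc y b != 0 by apply: other => //; rewrite yc.
have {other} xc' : inc x c != 0 by rewrite xc.
have yc' : inc y c != 0 by rewrite yc.
have Ox d : d != a -> d != c -> inc x d = 0 by exact: root_other.
have Oy d : d != b -> d != c -> inc y d = 0 by exact: root_other.
(* The symmetrised form is -1, and [c] alone already contributes -1. *)
have xb : inc x b = 0.
  have := ef_sym x y; rewrite exy eyx (sum_two bc) => [|d db dc].
    by rewrite xc yc; lia.
  by rewrite Oy ?mulr0.
have ya : inc y a = 0.
  have := ef_sym x y; rewrite exy eyx (sum_two ac) => [|d db dc].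
    by rewrite xc yc; lia.
  by rewrite Ox ?mul0r.
have dx := root_defect rx ac xa xc'; have dy := root_defect ry bc yb yc'.
have [m xm] := root_values rx; have [n yn] := root_values ry.
have m0 : 0 <= m.
  by case: (inc_values xm xc') => -[]; have := x0 (hd c); lia.
have n0 : 0 <= n.
  by case: (inc_values yn yc') => -[]; have := y0 (tl c); lia.
move: eyx; rewrite ef_tl (sum_two ac) => [|d da dc]; last by rewrite Ox ?mulr0.
have yta : y (hd a) = y (tl a) by move: ya; rewrite /inc; lia.
have xtb : x (hd b) = x (tl b) by move: xb; rewrite /inc; lia.
have xtc : x (hd c) = m /\ x (tl c) = m + 1.
  by case: (inc_values xm xc') => -[-> ->] //; lia.
have ytc : y (hd c) = n + 1 /\ y (tl c) = n.
  by case: (inc_values yn yc') => -[-> ->] //; lia.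
have incP (u v : T -> int) d :
    inc (fun i => u i * v i) d = u (hd d) * v (hd d) - u (tl d) * v (tl d) by [].
case: (inc_values xm xa) => -[hxa txa ixa]; case: (inc_values yn yb) => -[hyb tyb iyb].
(* Here [x] is regular and [y] is not; the product [x * (y - n)] vanishes at [s] and [t] but
   increases along [a]. *)
- have [ys yt] : y s = n /\ y t = n + 1 by case: (yn s); case: (yn t); lia.
  have xst : x s = x t by lia.
  rewrite ixa xc ytc.2 ys yt xst => e.
  have [xt yta1 m00] : [/\ x t = 0, y (tl a) = n + 1 & m = 0].
    by have := x0 t; case: (yn (tl a)); case: (xm t) => *; split; lia.
  have /= := @sum_inc_pos (fun i => x i * (y i - n)) a.
  rewrite incP xst xt !mul0r hxa txa yta yta1 m00 => /(_ erefl).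
  have h d : 0 <= inc (fun i => x i * (y i - n)) d.
    rewrite incP; have [->|db] := eqVneq d b.
      by rewrite hyb tyb; have := x0 (hd b); lia.
    have [->|dc] := eqVneq d c.
      by rewrite xtc.1 xtc.2 ytc.1 ytc.2 m00; lia.
    have := Oy _ db dc; have [->|da] := eqVneq d a.
      by rewrite hxa txa yta yta1 m00; lia.
    by have := Ox _ da dc; rewrite /inc => /subr0_eq -> /subr0_eq ->; rewrite subrr.
  by move=> /(_ h); lia.
(* Both are regular: the form gives [y (tl a) = n + 1], so [x + y] is at least 2 at [hd a]. *)
- have xst : x s = x t by lia.
  have yst : y s = y t by lia.
  rewrite ixa xc ytc.2 xst yst => e.
  have := bnd _ (hd a); rewrite hxa yta => /(_ _) h.
  by have := h ltac:(lia); lia.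
(* Neither is regular: the form reduces to [m + y (tl a) = -1]. *)
- have [ys yt] : y s = n /\ y t = n + 1 by case: (yn s); case: (yn t); lia.
  have [xs xt] : x s = m + 1 /\ x t = m by case: (xm s); case: (xm t); lia.
  by rewrite ixa xc ytc.2 xs xt ys yt => e; have := y0 (tl a); lia.
(* Here only [y] is regular; the product of the complements [m + 1 - x] and [n + 1 - y] plays the
   same role. *)
- have [xs xt] : x s = m + 1 /\ x t = m by case: (xm s); case: (xm t); lia.
  have yst : y s = y t by lia.
  rewrite ixa xc ytc.2 xs xt yst => e.
  have [yta1 n00 yt] : [/\ y (tl a) = 0, n = 0 & y t = 1].
    by have := y0 (tl a); case: (yn (tl a)); case: (yn t) => *; split; lia.
  have /= := @sum_inc_pos (fun i => (m + 1 - x i) * (n + 1 - y i)) a.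
  rewrite incP xs xt yst yt hxa txa yta yta1 n00 => /(_ ltac:(lia)).
  have h d : 0 <= inc (fun i => (m + 1 - x i) * (0 + 1 - y i)) d.
    rewrite incP; have [->|db] := eqVneq d b.
      by rewrite hyb tyb; case: (xm (hd b)) => ->; lia.
    have [->|dc] := eqVneq d c.
      by rewrite xtc.1 xtc.2 ytc.1 ytc.2 n00; lia.
    have := Oy _ db dc; have [->|da] := eqVneq d a.
      by rewrite hxa txa yta yta1; lia.
    by have := Ox _ da dc; rewrite /inc => /subr0_eq -> /subr0_eq ->; rewrite subrr.
  by move=> /(_ h); lia.
Qed.

(** After a change of sign [y] only decreases along arrows. If [x] had an entry 2, its smaller value
    [m] would be positive, and a vanishing form would fix how [x] and [y] interlace, making
    [(x - m) * (n + 1 - y)] increase without ever decreasing. *)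
Lemma regular_root_le1 x y : real_root x -> nonneg x -> x s = x t ->
  real_root y -> y s != y t -> ef x y = 0 \/ ef y x = 0 -> forall i, x i <= 1.
Proof.
move=> rx /nonnegP x0 xst.
wlog yst : y / y s - y t = 1 => [hw ry yst exy|ry _ exy i].
  case: (root_supportP ry) => a b ab ya yb _.
  have := root_defect ry ab ltac:(lia) ltac:(lia) => dy.
  have [y1|y1] : y s - y t = 1 \/ y s - y t = -1 by lia.
    exact: hw y1 ry yst exy.
  apply: (hw (fun i => - y i)); [lia|exact: rootN|lia|].
  by rewrite ef_oppl ef_oppr; lia.
have [m xm] := root_values rx; have [n yn] := root_values ry.
rewrite leNgt; apply/negP => xi.
have [ys yt] : y s = n + 1 /\ y t = n by case: (yn s); case: (yn t); lia.
have m1 : 1 <= m by case: (xm i); lia.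
have y_le0 d : inc y d <= 0.
  case: (root_supportP ry) => a b ab ya yb y0.
  have := root_defect ry ab ltac:(lia) ltac:(lia) => dy.
  have [->|da] := eqVneq d a; first by lia.
  have [->|db] := eqVneq d b; first by lia.
  by rewrite y0.
have [a [b [ab xa xb xO]]] : exists a b, [/\ a != b, inc x a = 1, inc x b = -1 &
    forall c, c != a -> c != b -> inc x c = 0].
  case: (root_supportP rx) => a b ab xa xb xO.
  have := root_defect rx ab ltac:(lia) ltac:(lia) => dx.
  have [xa1|xa1] : inc x a = 1 \/ inc x a = -1 by lia.
    by exists a, b; split=> //; lia.
  exists b, a; split=> //; [by rewrite eq_sym|lia|].
  by move=> c cb ca; exact: xO.
have [hxa txa] : x (hd a) = m + 1 /\ x (tl a) = m.
  by case: (@inc_values x m a xm ltac:(lia)) => -[]; lia.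
have [hxb txb] : x (hd b) = m /\ x (tl b) = m + 1.
  by case: (@inc_values x m b xm ltac:(lia)) => -[]; lia.
(* Either form vanishes only if [x s] equals a difference of two values of [y], so [x s = 1 = m]. *)
have [xs yha ytb] : [/\ x s = m, y (hd a) = n & y (tl b) = n + 1].
  have := y_le0 a; have := y_le0 b; rewrite /inc => ya yb.
  case: exy; rewrite ?(ef_hd x) ?(ef_tl _ x) (sum_two ab) ?xa ?xb ?ys ?yt -?xst.
  - move=> e; case: (xm s) => e'; move: e; rewrite e';
    case: (yn (hd a)) ya yb; case: (yn (tl a)); case: (yn (hd b));
    case: (yn (tl b)) => *; split; lia.
  - by move=> c ca cb; rewrite xO ?mul0r.
  - move=> e; case: (xm s) => e'; move: e; rewrite e';
    case: (yn (hd a)) ya yb; case: (yn (tl a)); case: (yn (hd b));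
    case: (yn (tl b)) => *; split; lia.
  - by move=> c ca cb; rewrite xO ?mulr0.
have := @sum_inc_pos (fun i => (x i - m) * (n + 1 - y i)) a.
rewrite /= -xst xs subrr !mul0r => /(_ erefl).
have h d : 0 <= inc (fun i => (x i - m) * (n + 1 - y i)) d.
  have := y_le0 d; rewrite /inc.
  have [->|da] := eqVneq d a.
    by rewrite hxa txa yha; lia.
  have [->|db] := eqVneq d b.
    by rewrite hxb txb ytb; lia.
  have := xO _ da db; rewrite /inc => /subr0_eq ->.
  by case: (xm (tl d)) => ->; lia.
by move=> /(_ h); rewrite /inc hxa txa yha; lia.
Qed.

(* Two such roots add up to a multiple of the null root, so their Euler forms with
   [z] cannot cancel. *)
Lemma complementary_roots x y z : real_root x -> real_root y -> nonneg x = nonneg y ->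
  x s = x t -> (forall a, inc x a = - inc y a) -> z s != z t ->
  [\/ [/\ ef x z <= 0, ef y z <= 0, ef z x <= 0 & ef z y <= 0],
      ef z x = 0 /\ ef z y = 0 | ef x z = 0 /\ ef y z = 0] -> False.
Proof.
move=> rx ry sgn xst opp zst.
pose l := x s + y s.
have xl i : x i + 1 * y i = l.
  have := conn (x := fun i => x i + y i) _ i s; rewrite /l mul1r; apply.
  by move=> a; have := opp a; rewrite /inc; lia.
have l0 : l != 0.
  have [i [j xij]] := root_not_const rx; apply: contra_notN xij => /eqP l0.
  have := xl i; have := xl j; rewrite l0.
  have [xn|xn] := boolP (nonneg x).
    move: (xn); rewrite sgn => /nonnegP yn; move/nonnegP: xn => xn.
    by have := yn i; have := yn j; have := xn i; have := xn j; lia.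
  have yn : ~~ nonneg y by rewrite -sgn.
  by have := root_neg i rx xn; have := root_neg j rx xn;
     have := root_neg i ry yn; have := root_neg j ry yn; lia.
have e1 : ef x z + 1 * ef y z = l * (z s - z t).
  by rewrite -ef_addl (@eq_ef _ (fun=> l) z z) // ef_constl.
have e2 : ef z x + 1 * ef z y = l * (z t - z s).
  by rewrite -ef_addr (@eq_ef z z _ (fun=> l)) // ef_constr.
have {}zst : z s - z t != 0 by lia.
have : l * (z s - z t) != 0 by rewrite mulf_neq0.
have : l * (z t - z s) = - (l * (z s - z t)) by ring.
by move=> h1 h2 [[? ? ? ?]|[? ?]|[? ?]]; lia.
Qed.

(** * Frames and their mutations *)

Implicit Types (c : T -> T -> int) (i j k r : T).

Definition el c i j a :=
  eloc (inc (c i) a) (nonneg (c i)) (inc (c j) a) (nonneg (c j)).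

(** The invariant of a seed. The non-regular vector of [frame_defect] serves as the partner against
    which regular vectors are compared. *)
Record frame c : Prop := Frame {
  frame_root : forall i, real_root (c i);
  frame_slot : forall i j a, i != j ->
    slot_neq (inc (c i) a) (nonneg (c i)) (inc (c j) a) (nonneg (c j));
  frame_ef : forall i j, i != j -> ef (c i) (c j) = \sum_a el c i j a;
  frame_defect : exists i, c i s != c i t
}.

Section Frame.

Variables (c : T -> T -> int) (frc : frame c).

Let rc := frame_root frc.

Lemma frame_inc i a : `|inc (c i) a| <= 1. Proof. exact: root_inc. Qed.

Lemma frame_ef_same_sign i j : i != j -> nonneg (c i) = nonneg (c j) ->
  ef (c i) (c j) <= 0.
Proof.
move=> ij sgn; rewrite (frame_ef frc) // /el sgn; apply: sumr_le0 => a _.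
exact: eloc_same_sign.
Qed.

Lemma frame_ef_neg_pos i j : ~~ nonneg (c i) -> nonneg (c j) -> ef (c i) (c j) = 0.
Proof.
move=> ci cj; have ij : i != j by apply: contraNneq ci => ->.
rewrite (frame_ef frc) // big1 // => a _.
by rewrite /el (negPf ci) cj eloc_neg_pos.
Qed.

(** Both vectors are compared with a non-regular one, whose sign decides which Euler forms vanish or
    are nonpositive. *)
Lemma frame_no_complement i j : i != j -> nonneg (c i) = nonneg (c j) ->
  c i s = c i t -> (forall a, inc (c i) a = - inc (c j) a) -> False.
Proof.
move=> ij sgn ist opp; have [l lst] := frame_defect frc.
have jst : c j s = c j t.
  have := sum_inc (c i); under eq_bigr do rewrite opp.
  by rewrite sumrN (sum_inc (c j)); lia.
have il : i != l by apply: contraNneq lst => <-; apply/eqP.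
have jl : j != l by apply: contraNneq lst => <-; apply/eqP.
apply: (complementary_roots (rc i) (rc j) sgn ist opp lst).
have [sl|sl] := eqVneq (nonneg (c l)) (nonneg (c i)).
  constructor 1; split; apply: frame_ef_same_sign => //; rewrite 1?eq_sym //.
  - by rewrite -sgn.
  - by rewrite sl.
have [ni|ni] := boolP (nonneg (c i)); move: sl sgn; rewrite ?ni ?(negPf ni) => sl sgn.
  constructor 2; split; apply: frame_ef_neg_pos; rewrite -?sgn //.
    by move: sl; case: nonneg.
  by move: sl; case: nonneg.
constructor 3; split; apply: frame_ef_neg_pos; rewrite -?sgn //.
  by move: sl; case: nonneg.
by move: sl; case: nonneg.
Qed.

Lemma frame_regular i r : c i s = c i t -> `|c i r| <= 1.
Proof.
move=> ist; have [j jst] := frame_defect frc.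
have ij : i != j by apply: contraNneq jst => <-; apply/eqP.
(* If [c j] changed at both arrows of [c i], it would do so with opposite signs and be regular. So
   they meet at no more than one arrow, which contributes to at most one of the two forms. *)
have e0 : ef (c i) (c j) = 0 \/ ef (c j) (c i) = 0.
  case: (root_supportP (rc i)) => a b ab ia ib iO.
  have ji : j != i by rewrite eq_sym.
  have elij d : d != a -> d != b -> el c i j d = 0.
    by move=> da db; rewrite /el iO ?eloc0l.
  have elji d : d != a -> d != b -> el c j i d = 0.
    by move=> da db; rewrite /el iO ?eloc0r.
  rewrite (frame_ef frc ij) (frame_ef frc ji) (sum_two ab elij) (sum_two ab elji).
  have ia0 : inc (c i) a != 0 by lia.
  have ib0 : inc (c i) b != 0 by lia.
  have di := root_defect (rc i) ab ia0 ib0.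
  have [ja|ja] := eqVneq (inc (c j) a) 0.
    by rewrite /el ja !eloc0l !eloc0r !add0r; exact: eloc_anti.
  have [jb|jb] := eqVneq (inc (c j) b) 0.
    by rewrite /el jb !eloc0l !eloc0r !addr0; exact: eloc_anti.
  have := root_shared_support (rc i) (rc j) ab ia0 ib0 ja jb.
  have := root_defect (rc j) ab ja jb.
  have := frame_inc j a; have := frame_inc j b.
  have : inc (c i) a = 1 \/ inc (c i) a = -1 by lia.
  have : inc (c i) b = - inc (c i) a by lia.
  move=> -> [->|->]; nia.
have [ni|ni] := boolP (nonneg (c i)).
  have := regular_root_le1 (rc i) ni ist (rc j) jst e0 r.
  by move/nonnegP: ni => /(_ r); lia.
have := @regular_root_le1 (fun r => - c i r) (c j) (rootN (rc i)).
rewrite root_negN // => /(_ ni); rewrite ist => /(_ erefl (rc j) jst).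
rewrite ef_oppl ef_oppr => /(_ _ r) h.
have := root_neg r (rc i) ni; have : - c i r <= 1 by apply: h; lia.
lia.
Qed.

Lemma frame_regularN i : c i s = c i t -> forall r, - c i r <= 1.
Proof. by move=> ist r; have := frame_regular r ist; lia. Qed.

End Frame.

(* [ef (c i) (c k) - ef (c k) (c i)] is the entry [b_ki] of the exchange matrix,
   so that [mult c k i] is the positive part of [sign (c k) * b_ki]. *)
Definition mult c k i : int :=
  let w := ef (c i) (c k) - ef (c k) (c i) in
  Num.max 0 (if nonneg (c k) then w else - w).

(** Mutation of c-vectors when [c k] is sign-coherent; [cmat_mutate] matches it with the matrix
    rule. *)
Definition mutv c k i r : int :=
  if i == k then - c k r else c i r + mult c k i * c k r.

(** * Mutation of a frame *)

Section Mutation.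

Variables (c : T -> T -> int) (k : T) (frc : frame c).

Let rc := frame_root frc.
Let c' := mutv c k.
Let m := mult c k.

Lemma mult_ge0 i : 0 <= m i.
Proof. by rewrite /m /mult le_max lexx. Qed.

Lemma mutvk r : c' k r = - c k r.
Proof. by rewrite /c' /mutv eqxx. Qed.

Lemma mutvE i r : i != k -> c' i r = c i r + m i * c k r.
Proof. by rewrite /c' /mutv => /negPf ->. Qed.

Lemma inc_mutvk d : inc (c' k) d = - inc (c k) d.
Proof. by rewrite /inc !mutvk; ring. Qed.

Lemma inc_mutv i d : i != k -> inc (c' i) d = inc (c i) d + m i * inc (c k) d.
Proof. by move=> ik; rewrite /inc !mutvE //; ring. Qed.

Lemma ef_mutvl i x : i != k -> ef (c' i) x = ef (c i) x + m i * ef (c k) x.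
Proof. by move=> ik; rewrite -ef_addl; apply: eq_ef => // r; rewrite mutvE. Qed.

Lemma ef_mutvr i x : i != k -> ef x (c' i) = ef x (c i) + m i * ef x (c k).
Proof. by move=> ik; rewrite -ef_addr; apply: eq_ef => // r; rewrite mutvE. Qed.

Lemma ef_mutvkl x : ef (c' k) x = - ef (c k) x.
Proof. by rewrite -ef_oppl; apply: eq_ef => // r; rewrite mutvk. Qed.

Lemma ef_mutvkr x : ef x (c' k) = - ef x (c k).
Proof. by rewrite -ef_oppr; apply: eq_ef => // r; rewrite mutvk. Qed.

Lemma nonneg_mutvk : nonneg (c' k) = ~~ nonneg (c k).
Proof.
by rewrite -(root_negN (rc k)); apply: eq_forallb => r; rewrite mutvk.
Qed.

Lemma root_of_ef x : ef x x = 1 -> real_root x.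
Proof.
move=> e; rewrite /real_root; under eq_bigr do rewrite expr2.
by rewrite -ef_sym e.
Qed.

(** The form from the negative to the positive vector vanishes, so the other one alone determines
    the multiplicity. *)
Lemma mult_opposite_sign i : m i != 0 -> nonneg (c i) != nonneg (c k) ->
  if nonneg (c k) then ef (c k) (c i) = - m i /\ ef (c i) (c k) = 0
  else ef (c i) (c k) = - m i /\ ef (c k) (c i) = 0.
Proof.
rewrite /m /mult; case: ifP => ck; case: (boolP (nonneg (c i))) => // ci m0 _.
  by have := frame_ef_neg_pos frc ci ck; move: m0; lia.
have := frame_ef_neg_pos frc (negbT ck) ci; move: m0; lia.
Qed.

(** The Tits form of [c i + m * c k] is [1 + m * (- m) + m ^ 2]. *)
Lemma root_mutv_of i : i != k -> (m i != 0 ->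
  ef (c i) (c k) + ef (c k) (c i) = - m i) -> real_root (c' i).
Proof.
move=> ik h; apply: root_of_ef; rewrite ef_mutvl // !ef_mutvr //.
rewrite !ef_root //.
have [->|/h e] := eqVneq (m i) 0; first by ring.
have -> : ef (c i) (c k) = - m i - ef (c k) (c i) by lia.
ring.
Qed.

Lemma root_mutv_opposite i : i != k -> m i != 0 ->
  nonneg (c i) != nonneg (c k) -> real_root (c' i).
Proof.
move=> ik m0 sgn; apply: root_mutv_of => // _.
have := mult_opposite_sign m0 sgn; case: ifP; lia.
Qed.

(** The multiplicity is minus a sum of two products of increments, each at least -1; the value 2
    requires both to be -1. *)
Lemma mult_opposite_le2 i : m i != 0 -> nonneg (c i) != nonneg (c k) ->
  m i = 1 \/ m i = 2 /\ forall d, inc (c i) d = - inc (c k) d.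
Proof.
move=> m0 sgn; have e := mult_opposite_sign m0 sgn.
have {}e : ef (c i) (c k) + ef (c k) (c i) = - m i by case: ifP e; lia.
case: (root_supportP (rc k)) => a b ab ka kb kO.
move: e; rewrite ef_sym (sum_two ab) => [e|d da db]; last by rewrite kO ?mulr0.
have ia := frame_inc frc i a; have ib := frame_inc frc i b.
have m1 := mult_ge0 i.
have [?|m2] := eqVneq (m i) 1; first by left.
have [{}ia {}ib] : inc (c i) a = - inc (c k) a /\ inc (c i) b = - inc (c k) b by nia.
right; split; first by nia.
move=> d; have [->|da] := eqVneq d a => //; have [->|db] := eqVneq d b => //.
by rewrite kO // (root_other (rc i) ab _ _ da db) //; lia.
Qed.

(* A decrement moved to an arrow of [c k] can only go into the slot freed by
   [c k], which fixes the sign. *)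
Lemma mutv_sign_in i d : i != k -> m i != 0 -> nonneg (c i) != nonneg (c k) ->
  inc (c k) d = -1 -> inc (c' i) d != 0 -> nonneg (c' i) = nonneg (c k).
Proof.
move=> ik m0 sgn kd i'd; have e := mult_opposite_sign m0 sgn.
have r' := root_mutv_opposite ik m0 sgn.
have id' := root_inc d r'; have id := frame_inc frc i d.
case: (mult_opposite_le2 m0 sgn) => [m1|[m2 opp]].
  have {i'd}i'd : inc (c' i) d = -1 by move: i'd id'; rewrite inc_mutv // m1 kd; lia.
  case: ifP e => ck; rewrite ck in sgn *; rewrite m1 => -[e1 e2];
    case: (boolP (nonneg (c' i))) => // ci'; exfalso.
  - have ci : ~~ nonneg (c i) by move: sgn; case: nonneg.
    (* With the wrong sign, [c k] and [- c' i] are nonnegative roots adjacent at [d] whose sum is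
       [- c i], which has entries at most 1 if regular. *)
    apply: (@adjacent_roots_ef (c k) (fun r => - c' i r) d);
      rewrite ?root_negN //; try exact: rootN.
    + by rewrite incN i'd.
    + by rewrite ef_oppr ef_mutvr // m1 e1 ef_root //; ring.
    + by rewrite ef_oppl ef_mutvl // m1 e2 ef_root //; ring.
    + move=> st r; rewrite mutvE // m1.
      have ist : c i s = c i t by move: st; rewrite !mutvE // m1; lia.
      by have := frame_regularN frc ist r; lia.
  - have ci : nonneg (c i) by move: sgn; case: nonneg.
    apply: (@adjacent_roots_ef (c' i) (fun r => - c k r) d);
      rewrite ?root_negN //; try exact: rootN.
    + by rewrite ck.
    + by rewrite incN kd.
    + by rewrite ef_oppr ef_mutvl // m1 e1 ef_root //; ring.
    + by rewrite ef_oppl ef_mutvr // m1 e2 ef_root //; ring.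
    + move=> st r; rewrite mutvE // m1.
      have ist : c i s = c i t by move: st; rewrite !mutvE // m1; lia.
      by have := frame_regular frc r ist; lia.
(* Multiplicity 2: [c i + c k] is a constant [l], so [c' i = l + c k]. The Euler form yields [l = 1]
   or [l = -1] according to the sign of [c k]. *)
pose l := c i s + c k s.
have il r : c i r = l + -1 * c k r.
  have := conn (x := fun r => c i r + c k r) _ r s; rewrite -/l => h.
  have : c i r + c k r = l by apply: h => a; have := opp a; rewrite /inc; lia.
  lia.
have eik : ef (c i) (c k) = l * (c k s - c k t) - 1.
  rewrite (@eq_ef _ (fun r => l + -1 * c k r) (c k) (c k)) //.
  by rewrite (ef_addl (fun=> l)) ef_constl ef_root //; ring.
have eki : ef (c k) (c i) = l * (c k t - c k s) - 1.
  rewrite (@eq_ef (c k) (c k) _ (fun r => l + -1 * c k r)) //.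
  by rewrite (ef_addr (fun=> l)) ef_constr ef_root //; ring.
have kst : c k s - c k t = 0 \/ c k s - c k t = 1.
  case: (root_supportP (rc k)) => a b ab ka kb kO.
  have := root_defect (rc k) ab ltac:(lia) ltac:(lia).
  have [da|da] := eqVneq d a; first by rewrite -da kd; lia.
  have [db|db] := eqVneq d b; first by rewrite -db kd; lia.
  by move: kd; rewrite kO.
case: ifP e => ck; rewrite m2 => -[e1 e2].
- have l1 : l = 1 by move: e1; rewrite eki; case: kst; nia.
  apply/nonnegP => r; rewrite mutvE // il m2 l1.
  by have /nonnegP/(_ r) := ck; lia.
- have l1 : l = -1 by move: e1; rewrite eik; case: kst; nia.
  apply/negbTE; apply/negP => /nonnegP /(_ t); rewrite mutvE // il m2 l1.
  by have := root_neg t (rc k) (negbT ck); lia.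
Qed.

(** If the sign flipped, [c i] and [c' i], one of them negated, would be nonnegative roots adjacent
    at [d], with sum [c k] or [- c k]. *)
Lemma mutv_sign_out i d : i != k -> m i != 0 -> nonneg (c i) != nonneg (c k) ->
  inc (c k) d = 0 -> inc (c i) d = -1 -> nonneg (c' i) = nonneg (c i).
Proof.
move=> ik m0 sgn kd id; have e := mult_opposite_sign m0 sgn.
have r' := root_mutv_opposite ik m0 sgn.
have i'd : inc (c' i) d = -1 by rewrite inc_mutv // kd mulr0 addr0.
case: (mult_opposite_le2 m0 sgn) => [m1|[m2 opp]]; last first.
  by move: id; rewrite opp kd.
case: ifP e => ck; rewrite ck in sgn; rewrite m1 => -[e1 e2].
- have /negPf ci : ~~ nonneg (c i) by move: sgn; case: nonneg.
  rewrite ci; apply/negbTE/negP => ci'.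
  apply: (@adjacent_roots_ef (c' i) (fun r => - c i r) d);
      rewrite ?root_negN //; try exact: rootN.
  + by rewrite ci.
  + by rewrite incN id.
  + by rewrite ef_oppr ef_mutvl // m1 e1 ef_root //; ring.
  + by rewrite ef_oppl ef_mutvr // m1 e2 ef_root //; ring.
  + move=> st r; rewrite mutvE // m1.
    have kst : c k s = c k t by move: st; rewrite !mutvE // m1; lia.
    by have := frame_regular frc r kst; lia.
- have ci : nonneg (c i) by move: sgn; case: nonneg.
  rewrite ci; case: (boolP (nonneg (c' i))) => // ci'; exfalso.
  apply: (@adjacent_roots_ef (c i) (fun r => - c' i r) d);
      rewrite ?root_negN //; try exact: rootN.
  + by rewrite incN i'd.
  + by rewrite ef_oppr ef_mutvr // m1 e1 ef_root //; ring.
  + by rewrite ef_oppl ef_mutvl // m1 e2 ef_root //; ring.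
  + move=> st r; rewrite mutvE // m1.
    have kst : c k s = c k t by move: st; rewrite !mutvE // m1; lia.
    by have := frame_regularN frc kst r; lia.
Qed.

Lemma mutv_sign_same i : i != k -> real_root (c' i) -> m i = 0 \/ nonneg (c i) = nonneg (c k) ->
  nonneg (c' i) = nonneg (c i).
Proof.
move=> ik r' [m0|sgn].
  by apply: eq_forallb => r; rewrite mutvE // m0 mul0r addr0.
have m1 := mult_ge0 i.
case: (boolP (nonneg (c i))) (sgn) => [/nonnegP ci|ci] /esym ck.
  apply/nonnegP => r; rewrite mutvE //; have := ci r.
  by move/nonnegP: ck => /(_ r); nia.
apply/negbTE/negP => /nonnegP ci'; have [x [y]] := root_not_const r'.
have := ci' x; have := ci' y; rewrite !mutvE //.
have := root_neg x (rc i) ci; have := root_neg y (rc i) ci.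
have := root_neg x (rc k) (negbT ck); have := root_neg y (rc k) (negbT ck).
nia.
Qed.

(* Outside the support of [c k] the increments do not change, and a change of
   sign does not affect their slots. *)
Lemma mutv_sign_outside i d : i != k -> inc (c k) d = 0 -> inc (c i) d = -1 ->
  real_root (c' i) -> nonneg (c' i) = nonneg (c i).
Proof.
move=> ik kd id r'; have [m0|m0] := eqVneq (m i) 0.
  by apply: mutv_sign_same => //; left.
have [sgn|sgn] := eqVneq (nonneg (c i)) (nonneg (c k)); last exact: mutv_sign_out kd id.
by apply: mutv_sign_same => //; right.
Qed.

(** * Reduction to the two arrows of the mutated vector *)

Section Support.

Variables (a b : A) (ab : a != b).
Hypotheses (ka : `|inc (c k) a| = 1) (kb : `|inc (c k) b| = 1).
Hypothesis kO : forall d, d != a -> d != b -> inc (c k) d = 0.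

Lemma ef_supportl i : i != k -> ef (c i) (c k) = el c i k a + el c i k b.
Proof.
move=> ik; rewrite (frame_ef frc ik) (sum_two ab) // => d da db.
by rewrite /el kO ?eloc0r.
Qed.

Lemma ef_supportr i : i != k -> ef (c k) (c i) = el c k i a + el c k i b.
Proof.
move=> ik; rewrite (frame_ef frc) 1?eq_sym // (sum_two ab) // => d da db.
by rewrite /el kO ?eloc0l.
Qed.

Lemma mult_local i : i != k ->
  m i = lmult (inc (c k) a) (inc (c k) b) (nonneg (c k))
              (inc (c i) a) (inc (c i) b) (nonneg (c i)).
Proof.
by move=> ik; rewrite /m /mult ef_supportl // ef_supportr.
Qed.

(** The new sign [p'] is left free: [root_mutv] takes the sign of [c k], before [c' i] is known to
    be a root, and [mutv_admissible] the actual sign. *)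
Lemma admissible_of i p' : i != k ->
  (m i = 0 \/ nonneg (c i) = nonneg (c k) -> p' = nonneg (c i)) ->
  (m i != 0 -> nonneg (c i) != nonneg (c k) -> forall d, inc (c k) d = -1 ->
     inc (c' i) d != 0 -> p' = nonneg (c k)) ->
  admissible (inc (c k) a) (inc (c k) b) (nonneg (c k))
    (inc (c i) a) (inc (c i) b) (nonneg (c i)) p'.
Proof.
move=> ik same enter; rewrite /admissible -mult_local // !(frame_slot frc) //=.
rewrite -!inc_mutv //; apply/and4P; split.
- apply/implyP => /andP[ia ib]; apply/eqP.
  by apply: (root_shared_support (rc i) (rc k) ab ia ib); lia.
- apply/negP => /and4P[/eqP sgn /eqP ia /eqP ib /eqP kab].
  apply: (frame_no_complement frc ik sgn).
    by have := root_defect (rc i) ab ltac:(lia) ltac:(lia); lia.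
  move=> d; have [->//|da] := eqVneq d a; have [->//|db] := eqVneq d b.
  by rewrite kO // (root_other (rc i) ab _ _ da db) //; lia.
- apply/implyP => /orP[/eqP|/eqP] h; apply/eqP; apply: same; [by left|by right].
- apply/implyP => /andP[m0 h].
  have [sgn|sgn] := eqVneq (nonneg (c i)) (nonneg (c k)).
    by apply/eqP; rewrite -sgn; apply: same; right.
  apply/eqP; case/orP: h => /andP[/eqP kd id]; exact: enter kd id.
Qed.

Lemma root_mutv i : i != k -> real_root (c' i).
Proof.
move=> ik; apply: root_mutv_of => // m0.
have h : admissible (inc (c k) a) (inc (c k) b) (nonneg (c k))
    (inc (c i) a) (inc (c i) b) (nonneg (c i)) (nonneg (c k)).
  by apply: admissible_of => // -[m0'|//]; rewrite m0' eqxx in m0.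
have /and5P[] := admissible_ok ka kb (frame_inc frc i a) (frame_inc frc i b) h.
rewrite -mult_local // m0 /= => /eqP e _ _ _ _.
by rewrite ef_supportl // ef_supportr.
Qed.

Lemma mutv_admissible i : i != k ->
  admissible (inc (c k) a) (inc (c k) b) (nonneg (c k))
    (inc (c i) a) (inc (c i) b) (nonneg (c i)) (nonneg (c' i)).
Proof.
move=> ik; have r' := root_mutv ik; apply: admissible_of => //.
  exact: mutv_sign_same.
by move=> m0 sgn d kd id; exact: mutv_sign_in kd id.
Qed.

(** At [a] and [b] the finite verification applies; at all other arrows slots and increments of the
    vectors other than [c k] are unchanged. *)
Lemma frame_mutv_support : frame c'.
Proof.
have slk i d : i != k ->
    slot_neq (inc (c' i) d) (nonneg (c' i)) (inc (c' k) d) (nonneg (c' k)).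
  move=> ik; rewrite nonneg_mutvk inc_mutvk inc_mutv //.
  have /and5P[_ ha hb _ _] := admissible_ok ka kb (frame_inc frc i a)
    (frame_inc frc i b) (mutv_admissible ik).
  have [->|da] := eqVneq d a; first by rewrite mult_local.
  have [->|db] := eqVneq d b; first by rewrite mult_local.
  by rewrite (kO da db) oppr0 /slot_neq eqxx orbT.
have ok2 i j : i != k -> j != k -> i != j -> mutation_ok2
    (inc (c k) a) (inc (c k) b) (nonneg (c k))
    (inc (c i) a) (inc (c i) b) (nonneg (c i)) (nonneg (c' i))
    (inc (c j) a) (inc (c j) b) (nonneg (c j)) (nonneg (c' j)).
  move=> ik jk ij; apply: admissible_ok2; rewrite ?(frame_slot frc) //;
    try exact: frame_inc; try exact: mutv_admissible.
  apply/implyP => /andP[/andP[/andP[ia ib] ja] jb]; apply/eqP.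
  exact: (root_shared_support (rc i) (rc j) ab).
have out i d : i != k -> d != a -> d != b ->
    inc (c' i) d = inc (c i) d /\ (inc (c i) d = -1 -> nonneg (c' i) = nonneg (c i)).
  move=> ik da db; rewrite inc_mutv // kO // mulr0 addr0; split=> // id.
  by apply: (mutv_sign_outside ik _ id (root_mutv ik)); rewrite kO.
split.
- move=> i; have [->|ik] := eqVneq i k; last exact: root_mutv.
  have := rootN (rc k); rewrite /real_root => <-; apply: eq_bigr => d _.
  by rewrite inc_mutvk incN.
- move=> i j d ij; have [ek|jk] := eqVneq j k; first by rewrite ek in ij *; exact: slk.
  have [ek|ik] := eqVneq i k; first by rewrite ek slot_neq_sym; exact: slk.
  have /and3P[ha hb _] := ok2 i j ik jk ij.
  have [->|da] := eqVneq d a; first by rewrite !inc_mutv // !mult_local.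
  have [->|db] := eqVneq d b; first by rewrite !inc_mutv // !mult_local.
  have [ei si] := out i d ik da db; have [ej sj] := out j d jk da db.
  rewrite ei ej; have := frame_slot frc d ij.
  by rewrite /slot_neq (slot_eq si) (slot_eq sj).
- move=> i j ij; have [ek|jk] := eqVneq j k.
    rewrite ek in ij *; rewrite ef_mutvkr ef_mutvl // ef_root // mulr1.
    have /and5P[_ _ _ /eqP e _] := admissible_ok ka kb (frame_inc frc i a)
      (frame_inc frc i b) (mutv_admissible ij).
    rewrite (sum_two ab) => [|d da db]; last by rewrite /el inc_mutvk kO // eloc0r.
    rewrite /el !inc_mutvk !inc_mutv // nonneg_mutvk ef_supportl //.
    by rewrite !mult_local // e.
  have [ek|ik] := eqVneq i k.
    rewrite ek in ij *; rewrite ef_mutvkl ef_mutvr // ef_root // mulr1.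
    have /and5P[_ _ _ _ /eqP e] := admissible_ok ka kb (frame_inc frc j a)
      (frame_inc frc j b) (mutv_admissible jk).
    rewrite (sum_two ab) => [|d da db]; last by rewrite /el inc_mutvk kO // eloc0l.
    rewrite /el !inc_mutvk !inc_mutv // nonneg_mutvk ef_supportr //.
    by rewrite !mult_local // e.
  have /and3P[_ _ /eqP e] := ok2 i j ik jk ij.
  rewrite ef_mutvl // !ef_mutvr // (ef_root (rc k)) mulr1.
  rewrite (frame_ef frc ij) (sum_split_two _ ab) [RHS](sum_split_two _ ab).
  have -> : \sum_(d | (d != a) && (d != b)) el c' i j d
          = \sum_(d | (d != a) && (d != b)) el c i j d.
    apply: eq_bigr => d /andP[da db].
    have [ei si] := out i d ik da db; have [ej sj] := out j d jk da db.
    by rewrite /el ei ej; exact: eloc_eq.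
  have -> : el c' i j a + el c' i j b = el c i j a + el c i j b
      + m j * ef (c i) (c k) + m i * ef (c k) (c j) + m i * m j.
    by rewrite ef_supportl // ef_supportr // /el !inc_mutv // !mult_local.
  ring.
(* If all new vectors were regular, so would be [c k], and then all the old ones. *)
- apply/existsP; apply: contraT => /existsPn h.
  have [j jst] := frame_defect frc.
  have kst : c k s = c k t by have /negPn/eqP := h k; rewrite !mutvk; lia.
  have [ek|jk] := eqVneq j k; first by rewrite ek kst eqxx in jst.
  have /negPn/eqP := h j; rewrite !mutvE // kst => /addIr e.
  by rewrite e eqxx in jst.
Qed.

End Support.

Lemma frame_mutv : frame c'.
Proof.
by case: (root_supportP (rc k)) => a b ab ka kb kO; exact: frame_mutv_support kO.
Qed.

End Mutation.

(** * The initial frame *)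

Section Initial.

Hypotheses (noloop : forall a, tl a != hd a) (st : s != t).

Definition unitv (i r : T) : int := if r == i then 1 else 0.

Lemma nonneg_unitv i : nonneg (unitv i).
Proof. by apply/nonnegP => r; rewrite /unitv; case: ifP. Qed.

Lemma inc_unitv i a : inc (unitv i) a = (hd a == i)%:Z - (tl a == i)%:Z.
Proof. by rewrite /inc /unitv; case: (hd a == i); case: (tl a == i). Qed.

Lemma ef_unitv i j :
  ef (unitv i) (unitv j) = (i == j)%:Z - \sum_a ((tl a == i) && (hd a == j))%:Z.
Proof.
rewrite /ef (bigD1 i) //= big1 => [|r /negPf ri]; last by rewrite /unitv ri mul0r.
rewrite /unitv eqxx mul1r addr0; congr (_ - _); first by case: (i == j).
by apply: eq_bigr => a _; case: (tl a == i); case: (hd a == j).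
Qed.

Lemma eq_andN (u v r : T) : u != v -> (r == u) && (r == v) = false.
Proof. by move=> uv; apply/negbTE; apply: contra uv => /andP[/eqP <-]. Qed.

Lemma eq_loopN a i : (hd a == i) && (tl a == i) = false.
Proof.
by apply/negbTE; apply: contra (noloop a) => /andP[/eqP -> /eqP ->].
Qed.

(** At an arrow from [i] to [j] the unit vectors occupy slots 1 and 2, contributing -1 to the form,
    as the arrow does by definition. *)
Lemma frame_unitv : frame unitv.
Proof.
split.
- move=> i; apply: root_of_ef; rewrite ef_unitv eqxx big1 ?subr0 // => a _.
  by rewrite andbC eq_loopN.
- move=> i j a ij; rewrite !nonneg_unitv !inc_unitv.
  move: (eq_andN (hd a) ij) (eq_andN (tl a) ij) (eq_loopN a i) (eq_loopN a j).
  by case: (hd a == i); case: (hd a == j); case: (tl a == i); case: (tl a == j).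
- move=> i j ij; rewrite ef_unitv (negPf ij) sub0r -sumrN; apply: eq_bigr => a _.
  rewrite /el !nonneg_unitv !inc_unitv.
  move: (eq_andN (hd a) ij) (eq_andN (tl a) ij) (eq_loopN a i) (eq_loopN a j).
  by case: (hd a == i); case: (hd a == j); case: (tl a == i); case: (tl a == j).
- by exists s; rewrite /unitv eqxx [t == s]eq_sym (negPf st).
Qed.

End Initial.

End SourceSink.

(** * Seeds of a source-sink cycle *)

(** With [u = b_ki] and [v = b_kj], the left side is the change of [b_ij] under matrix mutation; the
    right side is the change obtained from bilinearity when [c k] has sign [b]. *)
Lemma pos_part_mulB (u v : int) (b : bool) :
  pos_part (- u) * pos_part v - pos_part (- - u) * pos_part (- v)
  = Num.max 0 (if b then u else - u) * v - Num.max 0 (if b then v else - v) * u.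
Proof.
rewrite opprK /pos_part; case: b; rewrite ?opprK.
  by case: (leP (- u) 0); case: (leP v 0); case: (leP u 0); case: (leP (- v) 0);
     case: (leP 0 u); case: (leP 0 v); lia.
by case: (leP (- u) 0); case: (leP v 0); case: (leP u 0); case: (leP (- v) 0);
   case: (leP 0 (- u)); case: (leP 0 (- v)); lia.
Qed.

Section SourceSinkQuiver.

Variables (T : finType) (Q : quiver T) (s t : T).

Definition source_sink_degrees : Prop :=
  [/\ s != t,
      forall i, \sum_j (Q i j)%:Z = 1 + (i == s)%:Z - (i == t)%:Z &
      forall i, \sum_j (Q j i)%:Z = 1 - (i == s)%:Z + (i == t)%:Z].

Hypothesis degs : source_sink_degrees.

(** The index keeps parallel arrows apart, as the double edge on two vertices requires. *)
Definition arrow : finType := {p : T * T & 'I_(Q p.1 p.2)}.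
Definition atl (a : arrow) : T := (tag a).1.
Definition ahd (a : arrow) : T := (tag a).2.

Lemma sum_arrows (F : T -> T -> int) :
  \sum_(a : arrow) F (atl a) (ahd a) = \sum_i \sum_j (Q i j)%:Z * F i j.
Proof.
transitivity (\sum_(p : T * T) \sum_(k : 'I_(Q p.1 p.2)) F p.1 p.2).
  by rewrite sig_big_dep.
rewrite pair_big; apply: eq_bigr => p _.
by rewrite sumr_const card_ord -mulr_natl natz.
Qed.

Lemma sum_pred1 (f : T -> int) k : \sum_i (i == k)%:Z * f i = f k.
Proof.
rewrite (bigD1 k) //= eqxx mul1r big1 ?addr0 // => i /negPf ->.
by rewrite mul0r.
Qed.

Lemma sum_atl (f : T -> int) : \sum_a f (atl a) = \sum_i f i + f s - f t.
Proof.
have [_ out _] := degs; rewrite (sum_arrows (fun i _ => f i)).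
under eq_bigr do rewrite -mulr_suml out mulrBl mulrDl mul1r.
by rewrite sumrB big_split /= !sum_pred1.
Qed.

Lemma sum_ahd (f : T -> int) : \sum_a f (ahd a) = \sum_i f i - f s + f t.
Proof.
have [_ _ inn] := degs; rewrite (sum_arrows (fun _ j => f j)) exchange_big /=.
under eq_bigr do rewrite -mulr_suml inn mulrDl mulrBl mul1r.
by rewrite big_split sumrB /= !sum_pred1.
Qed.

Lemma arrow_const (x : T -> int) :
  (forall a, x (atl a) = x (ahd a)) -> forall i j, x i = x j.
Proof.
move=> xa i j.
have xQ u v : (0 < Q u v)%N -> x u = x v.
  by move=> uv; exact: (xa (Tagged (fun p => 'I_(Q p.1 p.2)) (Ordinal uv : 'I_(Q (u, v).1 (u, v).2)))).
have cl : closed [rel a b | (0 < Q a b + Q b a)%N] [pred r | x r == x i].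
  move=> u v /=; rewrite addn_gt0 => /orP[/xQ e|/xQ e]; by rewrite !inE e.
have := closed_connect cl (connected_quiver Q i j).
by rewrite !inE eqxx => /esym/eqP.
Qed.

Local Notation E := (ef atl ahd).
Local Notation frameQ := (frame atl ahd s t).

Lemma efE (x y : {ffun T -> int}) : E x y = euler_form Q x y.
Proof.
by rewrite /ef /euler_form (sum_arrows (fun i j => x i * y j)).
Qed.

Definition cmat (B : ext_matrix T) (j r : T) : int := B (inr r) j.

Record seed_frame (B : ext_matrix T) : Prop := SeedFrame {
  seed_frame_frame : frameQ (cmat B);
  seed_frame_ef : forall i j,
    B (inl i) j = E (cmat B j) (cmat B i) - E (cmat B i) (cmat B j)
}.

Lemma seed_frame_initial : seed_frame (initial_matrix Q).
Proof.
have [st _ _] := degs.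
have nl a : atl a != ahd a.
  case: a => -[i j] /= k; apply/eqP; rewrite /atl /ahd /= => e.
  by move: k; rewrite e no_loops => -[].
have -> : initial_matrix Q = fun r j => match r with
    inl i => (Q i j)%:Z - (Q j i)%:Z | inr i => unitv j i end.
  by apply/funext => -[i|i]; apply/funext => j.
split; first exact: (frame_unitv sum_atl sum_ahd nl st).
have Qe i j : \sum_a ((atl a == i) && (ahd a == j))%:Z = (Q i j)%:Z.
  rewrite (sum_arrows (fun u v => ((u == i) && (v == j))%:Z)).
  under eq_bigr => u _. under eq_bigr do rewrite mulrC -mulnb PoszM -mulrA.
    rewrite -mulr_sumr sum_pred1; over.
  by rewrite /= sum_pred1.
move=> i j; rewrite /cmat !ef_unitv !Qe [j == i]eq_sym; ring.
Qed.

Lemma pos_partE x : pos_part x = Num.max 0 x.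
Proof. by rewrite /pos_part maxC. Qed.

(** By sign-coherence of [c k], the same one of the two products of positive parts vanishes in every
    frozen row. *)
Lemma cmat_mutate B k : seed_frame B ->
  cmat (mutate k B) = mutv atl ahd (cmat B) k.
Proof.
move=> [frB eB]; apply/funext => j; apply/funext => r.
rewrite [LHS]/cmat /mutate /mutv /=; case: eqP => [->|_] //.
have rk := frame_root frB k.
rewrite eB /mult; set w := ef _ _ _ _ - ef _ _ _ _.
case: ifP => ck.
  have /nonnegP/(_ r) := ck; rewrite {1}/cmat => Bk.
  rewrite !pos_partE; case: (leP 0 (B (inr r) k)) Bk => // Bk _.
  have -> : Num.max 0 (- B (inr r) k) = 0 by lia.
  by rewrite mul0r subr0 mulrC.
have := root_neg sum_atl sum_ahd arrow_const r rk (negbT ck); rewrite {1}/cmat => Bk.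
rewrite !pos_partE.
have -> : Num.max 0 (B (inr r) k) = 0 by lia.
have -> : Num.max 0 (- B (inr r) k) = - B (inr r) k by lia.
by rewrite mul0r addr0 /cmat; ring.
Qed.

Lemma seed_frame_mutate B k : seed_frame B -> seed_frame (mutate k B).
Proof.
move=> sB; have [frB eB] := sB; split.
  by rewrite cmat_mutate //; exact: (frame_mutv sum_atl sum_ahd arrow_const k frB).
move=> i j; rewrite cmat_mutate //.
have rk := frame_root frB k.
rewrite /mutate /=; have [->|ik] := eqVneq i k.
  have [->|jk] := eqVneq j k; first by rewrite eqxx orbT eB; ring.
  rewrite eqxx eB !ef_mutvkl !ef_mutvkr !ef_mutvl // !ef_mutvr //; ring.
have [->|jk] := eqVneq j k.
  rewrite orbT eB !ef_mutvkl !ef_mutvkr !ef_mutvl // !ef_mutvr //; ring.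
have -> : (inl i == inl k :> T + T) = false by apply/eqP => -[]; apply/eqP.
rewrite /= !ef_mutvl // !ef_mutvr // (ef_root sum_atl sum_ahd) //.
have := pos_part_mulB (B (inl k) i) (B (inl k) j) (nonneg (cmat B k)).
have -> : B (inl i) k = - B (inl k) i by rewrite !eB; ring.
rewrite -addrA => ->; rewrite eB /mult -!eB !eB; ring.
Qed.

Lemma seed_frame_reachable ks : seed_frame (foldr (@mutate T) (initial_matrix Q) ks).
Proof.
by elim: ks => [|k ks ih] /=; [exact: seed_frame_initial|exact: seed_frame_mutate].
Qed.

Lemma cvectors_root c : cvectors Q c -> real_root atl ahd c.
Proof.
move=> [ks [j ->]]; have := frame_root (seed_frame_frame (seed_frame_reachable ks)) j.
rewrite /real_root => <-; apply: eq_bigr => a _.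
by rewrite /inc !ffunE.
Qed.

Lemma cvectors_diff c : cvectors Q c -> `|c s - c t| <= 1.
Proof.
move=> /cvectors_root rc.
have := root_range sum_atl sum_ahd arrow_const s t rc.
have := root_range sum_atl sum_ahd arrow_const t s rc; lia.
Qed.

Lemma cvectors_regular c r : cvectors Q c -> c s = c t -> `|c r| <= 1.
Proof.
move=> [ks [j ->]]; rewrite !ffunE => st.
exact: (frame_regular sum_atl sum_ahd arrow_const
  (seed_frame_frame (seed_frame_reachable ks)) r st).
Qed.

(** * Contraction to a double arrow and its c-vectors *)

Implicit Types (B : ext_matrix T) (i j k r : T) (S : {set T}).

Definition reachable (B : ext_matrix T) : Prop :=
  exists ks, B = foldr (@mutate T) (initial_matrix Q) ks.

Lemma reachable_mutate B k : reachable B -> reachable (mutate k B).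
Proof. by move=> [ks ->]; exists (k :: ks). Qed.

Lemma reachable_skew B i j : reachable B -> B (inl i) j = - B (inl j) i.
Proof.
move=> [ks ->]; have [_ e] := seed_frame_reachable ks.
by rewrite !e; ring.
Qed.

Lemma reachable_cvectors B j : reachable B -> cvectors Q (cvector B j).
Proof. by move=> [ks ->]; exists ks, j. Qed.

Lemma mutate_col B k (r : T + T) : mutate k B r k = - B r k.
Proof. by rewrite /mutate eqxx orbT. Qed.

Lemma mutate_row B k j : mutate k B (inl k) j = - B (inl k) j.
Proof. by rewrite /mutate eqxx. Qed.

Lemma mutate_frozen B k r j : j != k -> mutate k B (inr r) j =
  B (inr r) j + pos_part (B (inr r) k) * pos_part (B (inl k) j)
  - pos_part (- B (inr r) k) * pos_part (- B (inl k) j).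
Proof. by rewrite /mutate => /negPf ->. Qed.

Lemma mutate_mutable B k i j : i != k -> j != k -> mutate k B (inl i) j =
  B (inl i) j + pos_part (B (inl i) k) * pos_part (B (inl k) j)
  - pos_part (- B (inl i) k) * pos_part (- B (inl k) j).
Proof.
move=> /negPf ik /negPf jk; rewrite /mutate jk orbF.
by rewrite -[inl i == inl k]/(i == k) ik.
Qed.

(* The seeds met when contracting the two paths from [s] to [t]: the vertices in
   [S] still form a source-sink cycle, and only the c-vectors at [s] and [t]
   involve these two vertices. *)
Record contracted (B : ext_matrix T) (S : {set T}) : Prop := Contracted {
  contracted_reachable : reachable B;
  contracted_s : s \in S;
  contracted_t : t \in S;
  contracted_out : forall i, i \in S ->
    \sum_(j in S) pos_part (B (inl i) j) = 1 + (i == s)%:Z - (i == t)%:Z;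
  contracted_in : forall i, i \in S ->
    \sum_(j in S) pos_part (B (inl j) i) = 1 - (i == s)%:Z + (i == t)%:Z;
  contracted_vs : forall i, i \in S -> B (inr s) i = (i == s)%:Z;
  contracted_vt : forall i, i \in S -> B (inr t) i = (i == t)%:Z
}.

Lemma pos_part_ge0 x : 0 <= pos_part x.
Proof. by rewrite /pos_part; lia. Qed.

Lemma pos_part_id x : 0 <= x -> pos_part x = x.
Proof. by rewrite /pos_part; lia. Qed.

Lemma pos_part_eq0 x : x <= 0 -> pos_part x = 0.
Proof. by rewrite /pos_part; lia. Qed.

Lemma pos_part_eq0_le x : pos_part x = 0 -> x <= 0.
Proof. by rewrite /pos_part; lia. Qed.

Lemma contracted_initial : contracted (initial_matrix Q) [set: T].
Proof.
have [_ out inn] := degs.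
have e i j : pos_part (initial_matrix Q (inl i) j) = (Q i j)%:Z.
  by rewrite /pos_part /=; case: (no_2cycles Q i j) => ->; lia.
split; rewrite ?inE //; first by exists [::].
- move=> i _; under eq_bigr do rewrite e.
  by rewrite -out; apply: eq_bigl => j; rewrite inE.
- move=> i _; under eq_bigr do rewrite e.
  by rewrite -inn; apply: eq_bigl => j; rewrite inE.
- by move=> i _ /=; rewrite eq_sym; case: eqP.
- by move=> i _ /=; rewrite eq_sym; case: eqP.
Qed.

Lemma contract_successor B S u : contracted B S -> u \in S -> u != s -> u != t ->
  0 < B (inl s) u -> contracted (mutate u B) (S :\ u).
Proof.
move=> [rB sS tS out inn vs vt] uS us ut su.
have [st _ _] := degs.
have skew := reachable_skew _ _ rB.
have suS : s != u by rewrite eq_sym.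
have inu := inn u uS; rewrite (negPf us) (negPf ut) (bigD1 s) //= in inu.
set R := \sum_(i in S | _) _ in inu.
have ge0 : 0 <= R by apply: sumr_ge0 => i _; exact: pos_part_ge0.
rewrite (pos_part_id (ltW su)) in inu.
have [su1 S0] : B (inl s) u = 1 /\ R = 0.
  by move: su inu ge0; clear; move: (B _ u) R => x y; lia.
have ju j : j \in S -> j != s -> B (inl j) u <= 0.
  move=> jS js; have jSs : (j \in S) && (j != s) by rewrite jS.
  apply: pos_part_eq0_le.
  exact: (psumr_eq0P (fun i _ => pos_part_ge0 (B (inl i) u)) S0 jSs).
have js j : j \in S -> B (inl j) s <= 0.
  move=> jS; have S1 : \sum_(i in S) pos_part (B (inl i) s) = 0.
    by rewrite inn // eqxx (negPf st).
  apply: pos_part_eq0_le.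
  exact: (psumr_eq0P (fun i _ => pos_part_ge0 (B (inl i) s)) S1 jS).
have sj j : j \in S -> 0 <= B (inl s) j.
  by move=> /js; rewrite (skew j s) oppr_le0.
have uj j : j \in S -> j != s -> 0 <= B (inl u) j.
  by move=> jS /(ju j jS); rewrite (skew j u) oppr_le0.
have uu : B (inl u) u = 0 by have := skew u u; clear; move: (B _ u) => x; lia.
have us1 : B (inl u) s = - 1 by rewrite skew su1.
have Es j : j \in S -> j != u -> mutate u B (inl s) j = B (inl s) j + pos_part (B (inl u) j).
  move=> jS ju'.
  by rewrite mutate_mutable // su1 (@pos_part_id 1) // (@pos_part_eq0 (- 1)) // mul1r mul0r subr0.
have Ess : pos_part (mutate u B (inl s) s) = 0.
  rewrite Es // us1 (@pos_part_eq0 (- 1)) // addr0 pos_part_eq0 //.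
  exact: js.
have Ei i j : i \in S -> i != u -> i != s -> j \in S -> j != u -> j != s ->
    mutate u B (inl i) j = B (inl i) j.
  move=> iS iu is_ jS ju' js'; rewrite mutate_mutable //.
  rewrite (pos_part_eq0 (ju _ iS is_)) (@pos_part_eq0 (- B (inl u) j)).
    by rewrite mul0r mulr0 addr0 subr0.
  by rewrite oppr_le0 uj.
have Eis i : i \in S -> i != u -> i != s -> pos_part (mutate u B (inl i) s) = 0.
  move=> iS iu is_; rewrite mutate_mutable // us1 (pos_part_eq0 (ju _ iS is_)).
  rewrite mul0r addr0 pos_part_eq0 // subr_le0; apply: le_trans (js _ iS) _.
  by rewrite mulr_ge0 // pos_part_ge0.
split; rewrite ?inE ?sS ?tS ?suS 1?eq_sym ?ut //; first exact: reachable_mutate.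
- move=> i /setD1P[iu iS]; rewrite -out // (bigD1 u uS) /=.
  under eq_bigl do rewrite in_setD1 andbC.
  have [is_|is_] := eqVneq i s; last first.
    rewrite (pos_part_eq0 (ju _ iS is_)) add0r; apply: eq_bigr => j /andP[jS ju'].
    have [->|js'] := eqVneq j s; last by rewrite Ei.
    by rewrite Eis // (pos_part_eq0 (js _ iS)).
  have ou : \sum_(j in S | j != u) pos_part (B (inl u) j) = 1.
    have := out u uS; rewrite (negPf us) (negPf ut) (bigD1 u uS) /=.
    by rewrite uu (pos_part_eq0 (lexx 0)) add0r addr0 subr0.
  rewrite is_ (eq_bigr (fun j => pos_part (B (inl s) j) + pos_part (B (inl u) j))).
    by rewrite big_split /= ou su1 (@pos_part_id 1) // addrC.
  move=> j /andP[jS ju']; rewrite Es //.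
  by rewrite (pos_part_id (sj _ jS)) pos_part_id // addr_ge0 // ?sj // pos_part_ge0.
- move=> i /setD1P[iu iS]; rewrite -inn //.
  under eq_bigl do rewrite in_setD1 andbC.
  have [is_|is_] := eqVneq i s.
    rewrite is_ !big1 // => [j jS|j /andP[jS ju']]; first by rewrite pos_part_eq0 // js.
    by have [->|js'] := eqVneq j s; last exact: Eis.
  rewrite (bigD1 s) ?sS ?suS //= [RHS](bigD1 u) //= [in RHS](bigD1 s) ?sS ?suS //=.
  rewrite addrA; congr (_ + _).
    rewrite Es // pos_part_id ?addr_ge0 ?sj ?pos_part_ge0 //.
    by rewrite addrC (pos_part_id (sj _ iS)).
  by apply: eq_bigr => j /andP[/andP[jS ju'] js']; rewrite Ei.
(* The c-vector at [u] has entry zero at [s], so adding multiples of it changes nothing there. *)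
- move=> i /setD1P[iu iS]; have u0 : B (inr s) u = 0 by rewrite vs // (negPf us).
  rewrite mutate_frozen // u0 vs //.
  by rewrite !(pos_part_eq0 (lexx 0)) !mul0r addr0 subr0.
- move=> i /setD1P[iu iS]; have u0 : B (inr t) u = 0 by rewrite vt // (negPf ut).
  rewrite mutate_frozen // u0 vt //.
  by rewrite !(pos_part_eq0 (lexx 0)) !mul0r addr0 subr0.
Qed.

Lemma contracted_kronecker : exists2 B, reachable B &
  [/\ B (inl s) t = 2, B (inr s) s = 1, B (inr t) s = 0, B (inr s) t = 0
    & B (inr t) t = 1].
Proof.
have [st _ _] := degs.
have [n] := ubnP #|[set: T]|; move: contracted_initial.
move: (initial_matrix Q) [set: T] => B S.
elim: n B S => // n ih B S cB nS.
have [rB sS tS out _ vs vt] := cB.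
have [u /and4P[uS us ut su]|no] :=
  pickP (fun u => [&& u \in S, u != s, u != t & 0 < B (inl s) u]).
  apply: (ih _ (S :\ u)); first exact: contract_successor su.
  by move: nS; rewrite (cardsD1 u) uS add1n ltnS.
(* Now [s] has no successor in [S] other than [t], which receives both arrows. *)
exists B => //.
split; rewrite ?vs ?vt ?eqxx ?(negPf st) // 1?eq_sym ?(negPf st) //.
have ss : B (inl s) s = 0 by have := reachable_skew s s rB; lia.
have := out s sS; rewrite eqxx (negPf st) (bigD1 s) //= (bigD1 t) ?tS 1?eq_sym //=.
rewrite ss big1 => [|j /andP[/andP[jS js] jt]].
  by rewrite /pos_part; lia.
by have := no j; rewrite jS js jt /= /pos_part; lia.
Qed.

(** The projections follow the c-vectors of the Kronecker quiver: mutation at [i] replaces [c j] by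
    [c j + 2 * c i]. *)
Lemma preinjective_cvectors (k : nat) : exists B i j,
  [/\ reachable B, i != j & B (inl i) j = 2] /\
  [/\ B (inr s) i = k%:Z + 1, B (inr t) i = k%:Z,
      B (inr s) j = - k%:Z & B (inr t) j = - (k%:Z - 1)].
Proof.
elim: k => [|k [B [i [j [[rB ij b] [is_ it_ js jt]]]]]].
  have [B rB [b ss ts s_t tt]] := contracted_kronecker; exists B, s, t.
  by have [st _ _] := degs; rewrite ss ts s_t tt.
have ji : j != i by rewrite eq_sym.
exists (mutate i B), j, i; split; split=> //.
- exact: reachable_mutate.
- by rewrite mutate_col (reachable_skew _ _ rB) opprK.
- by rewrite mutate_frozen // b is_ js /pos_part; lia.
- by rewrite mutate_frozen // b it_ jt /pos_part; lia.
- by rewrite mutate_col is_; lia.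
- by rewrite mutate_col it_; lia.
Qed.

Lemma preprojective_cvectors (k : nat) : exists B i j,
  [/\ reachable B, i != j & B (inl i) j = 2] /\
  [/\ B (inr s) i = k%:Z - 1, B (inr t) i = k%:Z,
      B (inr s) j = - k%:Z & B (inr t) j = - (k%:Z + 1)].
Proof.
elim: k => [|k [B [i [j [[rB ij b] [is_ it_ js jt]]]]]].
  have [B rB [b ss ts s_t tt]] := contracted_kronecker.
  have [st _ _] := degs; have ts' : t != s by rewrite eq_sym.
  have b' := reachable_skew t s rB.
  (* Mutating at [t] and then [s] makes both projections negative; this starts the other family. *)
  exists (mutate s (mutate t B)), s, t; split; split=> //.
  - by do 2 apply: reachable_mutate.
  - by rewrite mutate_row mutate_col b opprK.
  - by rewrite mutate_col mutate_frozen // b' b ss s_t /pos_part; lia.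
  - by rewrite mutate_col mutate_frozen // b' b ts tt /pos_part; lia.
  - rewrite mutate_frozen // !mutate_col mutate_frozen // b' b ss s_t /pos_part; lia.
  - rewrite mutate_frozen // !mutate_col mutate_frozen // b' b ts tt /pos_part; lia.
have ji : j != i by rewrite eq_sym.
have b' := reachable_skew j i rB.
exists (mutate j B), j, i; split; split=> //.
- exact: reachable_mutate.
- by rewrite mutate_row b' b.
- by rewrite mutate_col js; lia.
- by rewrite mutate_col jt; lia.
- by rewrite mutate_frozen // b' b is_ js /pos_part; lia.
- by rewrite mutate_frozen // b' b it_ jt /pos_part; lia.
Qed.

Lemma filled_pm1 (d : int) : d = 1 \/ d = -1 -> filled Q s t d.
Proof.
have ex B i x y : reachable B -> B (inr s) i = x -> B (inr t) i = y ->
    exists2 c, cvectors Q c & Defs.proj s t c = (x, y).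
  move=> rB xe ye; exists (cvector B i); first exact: reachable_cvectors.
  by rewrite /Defs.proj !ffunE xe ye.
move=> d1 [x y] /= xy.
(* The sum [x + y] is odd. Each line takes its positive points from one family and its negative
   points from the other. *)
have [x0|x0] : 0 < x + y \/ x + y < 0 by lia.
  case: d1 => d1.
    have [B [i [j [[rB _ _] [is_ it_ _ _]]]]] := preinjective_cvectors `|y|%N.
    by apply: (ex B i) => //; lia.
  have [B [i [j [[rB _ _] [is_ it_ _ _]]]]] := preprojective_cvectors `|y|%N.
  by apply: (ex B i) => //; lia.
case: d1 => d1.
  have [B [i [j [[rB _ _] [_ _ js jt]]]]] := preprojective_cvectors `|x|%N.
  by apply: (ex B j) => //; lia.
have [B [i [j [[rB _ _] [_ _ js jt]]]]] := preinjective_cvectors `|x|%N.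
by apply: (ex B j) => //; lia.
Qed.

End SourceSinkQuiver.

(** * Euclidean diagrams and the null root *)

Local Open Scope classical_set_scope.

Lemma sum_edge_mult N E a : all (fun e => (e.1 < N)%N && (e.2 < N)%N) E ->
  (\sum_(b < N) edge_mult E a b =
   count (fun e => e.1 == a) E + count (fun e => e.2 == a) E)%N.
Proof.
elim: E => [_|[u v] E ih /= /andP[/andP[uN vN] /ih e]].
  by rewrite big1.
have s1 : (\sum_(b < N) ((u, v) == (a, b :> nat)) = (u == a))%N.
  rewrite (bigD1 (Ordinal vN)) //= big1 => [|b bv].
    by rewrite xpair_eqE eqxx andbT addn0.
  rewrite xpair_eqE; case: (v =P b) => [vb|_]; last by rewrite andbF.
  by rewrite -val_eqE /= vb eqxx in bv.
have s2 : (\sum_(b < N) ((u, v) == (b :> nat, a)) = (v == a))%N.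
  rewrite (bigD1 (Ordinal uN)) //= big1 => [|b bv].
    by rewrite xpair_eqE eqxx addn0.
  rewrite xpair_eqE; case: (u =P b) => [ub|_] //.
  by rewrite -val_eqE /= ub eqxx in bv.
rewrite addnACA -s1 -s2 -e -!big_split /=; apply: eq_bigr => b _.
by rewrite /edge_mult /= addnACA.
Qed.

Lemma underlying_degree (T : finType) (Q : quiver T) N E :
  underlying_graph Q N E -> all (fun e => (e.1 < N)%N && (e.2 < N)%N) E ->
  exists f : T -> 'I_N, bijective f /\ forall i, (\sum_j (Q i j + Q j i) =
    count (fun e => e.1 == f i :> nat) E
    + count (fun e => e.2 == f i :> nat) E)%N.
Proof.
move=> [f [bf QE]] wf; exists f; split=> // i.
rewrite -(sum_edge_mult _ wf) (reindex f) /=; last exact: onW_bij.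
by apply: eq_bigr => j _; rewrite QE.
Qed.

Lemma cycle_edges_wf n :
  all (fun e => (e.1 < n.+1)%N && (e.2 < n.+1)%N) (cycle_edges n).
Proof.
apply/allP => e /mapP[i]; rewrite mem_iota add0n => /andP[_ iN] -> /=.
by rewrite iN ltn_pmod.
Qed.

Lemma cycle_edges_degree n a : (a < n.+1)%N ->
  (count (fun e => e.1 == a) (cycle_edges n)
   + count (fun e => e.2 == a) (cycle_edges n) = 2)%N.
Proof.
move=> aN; rewrite /cycle_edges !count_map.
rewrite (@eq_count _ _ (pred1 a)) // count_uniq_mem ?iota_uniq // mem_iota add0n leq0n aN.
rewrite add1n; congr (_.+1).
(* The last edge is split off because it wraps around to 0. *)
have -> : iota 0 n.+1 = iota 0 n ++ [:: n] by rewrite -addn1 iotaD.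
rewrite count_cat /= modnn addn0.
rewrite (@eq_in_count _ _ (fun i => i.+1 == a)) => [|i]; last first.
  by rewrite mem_iota add0n /= => iN; rewrite modn_small.
case: a aN => [|a] aN; first by rewrite (@eq_count _ _ pred0) // count_pred0.
rewrite (@eq_count _ _ (pred1 a)) // count_uniq_mem ?iota_uniq // mem_iota add0n.
by rewrite leq0n -ltnS aN.
Qed.

(** The common feature of types D and E that rules them out: only two vertices can be [v] or [w]. *)
Definition three_leaves N (E : seq (nat * nat)) : Prop :=
  all (fun e => (e.1 < N)%N && (e.2 < N)%N) E /\
  exists L : seq nat, [/\ uniq L, size L = 3%N, all (fun a => a < N)%N L &
    all (fun a => (count (fun e => e.1 == a) E + count (fun e => e.2 == a) E == 1)%N) L].

Lemma Dtilde_leaves n : (4 <= n)%N -> three_leaves n.+1 (Dtilde_edges n).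
Proof.
move=> n4; split.
  rewrite /Dtilde_edges !all_cat; apply/and3P; split; [by rewrite /=; lia| |by rewrite /=; lia].
  by apply/allP => e /mapP[i]; rewrite mem_iota => iN -> /=; lia.
have ci (P : pred (nat * nat)) : (forall i, (2 <= i < n - 2)%N -> P (i, i.+1) = false) ->
    count P [seq (i, i.+1) | i <- iota 2 (n - 4)] = 0%N.
  move=> h; rewrite count_map; apply/eqP; rewrite -leqn0 leqNgt -has_count.
  apply/hasPn => i; rewrite mem_iota /= => iN; rewrite h //; lia.
exists [:: 0; 1; n]%N; split=> //.
- by rewrite /= !inE; lia.
- by rewrite /=; lia.
rewrite /Dtilde_edges /= !count_cat /= !ci /=; try by move=> i; lia.
by lia.
Qed.

Lemma euclidean_cases N E : euclidean N E ->
  (exists n, [/\ (1 <= n)%N, N = n.+1 & E = cycle_edges n]) \/ three_leaves N E.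
Proof.
case=> [n n1|n n4|||].
- by left; exists n.
- by right; exact: Dtilde_leaves.
(* The listed vertices are the tips of the three arms. *)
- by right; split=> //; exists [:: 2; 4; 6]%N.
- by right; split=> //; exists [:: 1; 4; 7]%N.
- by right; split=> //; exists [:: 1; 3; 8]%N.
Qed.

(** * The null root and the defect of unit vectors *)

Section NullRoot.

Variables (T : finType) (Q : quiver T).

Implicit Types (x y : {ffun T -> int}) (i j v w : T).

Definition basisv i : {ffun T -> int} := [ffun r => (r == i)%:Z].

Lemma euler_basisr x i :
  euler_form Q x (basisv i) = x i - \sum_j (Q j i)%:Z * x j.
Proof.
rewrite /euler_form; congr (_ - _).
  under eq_bigr do rewrite ffunE mulrC.
  by rewrite sum_pred1.
apply: eq_bigr => j _; under eq_bigr do rewrite ffunE mulrA mulrC.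
by rewrite sum_pred1.
Qed.

Lemma euler_basisl x i :
  euler_form Q (basisv i) x = x i - \sum_j (Q i j)%:Z * x j.
Proof.
rewrite /euler_form; congr (_ - _).
  under eq_bigr do rewrite ffunE.
  by rewrite sum_pred1.
rewrite exchange_big; apply: eq_bigr => j _ /=.
under eq_bigr do rewrite ffunE mulrCA.
by rewrite sum_pred1.
Qed.

Lemma tits_formD x y : tits_form Q (x + y)
  = tits_form Q x + tits_form Q y + (euler_form Q x y + euler_form Q y x).
Proof.
rewrite /tits_form /euler_form.
have -> : \sum_i (x + y) i ^+ 2
    = \sum_i x i ^+ 2 + \sum_i y i ^+ 2 + (\sum_i x i * y i + \sum_i y i * x i).
  by rewrite -!big_split /=; apply: eq_bigr => i _; rewrite ffunE; ring.
have -> : \sum_i \sum_j (Q i j)%:Z * ((x + y) i * (x + y) j)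
    = \sum_i \sum_j (Q i j)%:Z * (x i * x j) + \sum_i \sum_j (Q i j)%:Z * (y i * y j)
    + (\sum_i \sum_j (Q i j)%:Z * (x i * y j) + \sum_i \sum_j (Q i j)%:Z * (y i * x j)).
  rewrite -!big_split /=; apply: eq_bigr => i _.
  by rewrite -!big_split /=; apply: eq_bigr => j _; rewrite !ffunE; ring.
ring.
Qed.

Lemma tits_radicalP x : tits_radical Q x <->
  forall y, euler_form Q x y + euler_form Q y x = 0.
Proof.
split=> h y; have := h y; rewrite tits_formD.
  by move=> e; apply: (addrI (tits_form Q x + tits_form Q y)); rewrite e addr0.
by move=> ->; rewrite addr0.
Qed.

Variable delta : {ffun T -> int}.
Hypothesis null_delta : is_null_root Q delta.

Lemma null_root_gt0 i : 0 < delta i. Proof. by case: null_delta. Qed.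

Lemma null_root_radical y : euler_form Q delta y + euler_form Q y delta = 0.
Proof.
case: null_delta => _ _ rad; move: y; apply/tits_radicalP.
by rewrite rad; exists 1; rewrite mulr1z.
Qed.

Lemma null_root_neighbours i :
  \sum_j (Q j i)%:Z * delta j + \sum_j (Q i j)%:Z * delta j = 2 * delta i.
Proof.
have := null_root_radical (basisv i); rewrite euler_basisr euler_basisl.
set u := \sum_j _; set v := \sum_j _; lia.
Qed.

Lemma sum_degrees i : (\sum_j (Q i j + Q j i))%N%:Z =
  \sum_j (Q i j)%:Z + \sum_j (Q j i)%:Z.
Proof.
rewrite (big_morph Posz PoszD (erefl _)) -big_split /=.
by apply: eq_bigr.
Qed.

(** The all-ones vector lies in the radical, hence is an integer multiple of the positive vector
    [delta]. *)
Lemma null_root_eq1 :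
  (forall i, \sum_j (Q i j + Q j i) = 2)%N -> forall i, delta i = 1.
Proof.
move=> deg2 i; pose one : {ffun T -> int} := [ffun=> 1].
have : tits_radical Q one.
  apply/tits_radicalP => y.
  have -> : euler_form Q one y = \sum_j y j * (1 - \sum_k (Q k j)%:Z).
    rewrite /euler_form exchange_big -sumrB /=; apply: eq_bigr => j _.
    rewrite mulrBr mulr1 mulr_sumr ffunE mul1r; congr (_ - _).
    by apply: eq_bigr => k _; rewrite ffunE mul1r mulrC.
  have -> : euler_form Q y one = \sum_j y j * (1 - \sum_k (Q j k)%:Z).
    rewrite /euler_form -sumrB /=; apply: eq_bigr => j _.
    rewrite mulrBr mulr1 mulr_sumr ffunE mulr1; congr (_ - _).
    by apply: eq_bigr => k _; rewrite ffunE mulr1 mulrC.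
  rewrite -big_split big1 // => j _ /=.
  rewrite -mulrDr; have := sum_degrees j; rewrite deg2.
  set u := \sum_k _; set v := \sum_k _ => e.
  have -> : 1 - v + (1 - u) = 0 by lia.
  by rewrite mulr0.
case: null_delta => _ _ -> [k] /ffunP/(_ i); rewrite ffunE ffunMzE mulrzz.
move: (null_root_gt0 i); move: (delta i) => d d0 dk.
have k0 : 0 < k by rewrite -(pmulr_rgt0 _ d0) -dk.
by clear - d0 dk k0; nia.
Qed.

Lemma defect_basis i :
  defect Q delta (basisv i) = delta i - \sum_j (Q j i)%:Z * delta j.
Proof. exact: euler_basisr. Qed.

(** A leaf is a source, of defect [delta i], or a sink, of defect [- delta i] because its neighbour
    has twice its entry. *)
Lemma leaf_defect i : (\sum_j (Q i j + Q j i) = 1)%N ->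
  defect Q delta (basisv i) != 0.
Proof.
move=> leaf; have i0 := null_root_gt0 i.
have nb := null_root_neighbours i; rewrite defect_basis.
have [in0|out0] : (\sum_j Q j i = 0)%N \/ (\sum_j Q i j = 0)%N.
- by move: leaf; rewrite big_split /=; lia.
- rewrite big1 ?subr0 ?gt_eqF // => j _.
  by move/eqP: in0; rewrite sum_nat_eq0 => /forallP/(_ j)/eqP ->; rewrite mul0r.
move: nb; rewrite [X in _ + X]big1 => [|j _]; last first.
  by move/eqP: out0; rewrite sum_nat_eq0 => /forallP/(_ j)/eqP ->; rewrite mul0r.
set u := \sum_j _; lia.
Qed.

(** On unit vectors the defect is the out-degree minus one; the sign in the hypothesis decides which
    of [v] and [w] is the source. *)
Lemma difference_is_defect_degrees v w : v <> w ->
  (forall i, \sum_j (Q i j + Q j i) = 2)%N -> difference_is_defect Q delta v w ->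
  source_sink_degrees Q v w \/ source_sink_degrees Q w v.
Proof.
move=> vw deg2 dd; have d1 := null_root_eq1 deg2.
have db i : defect Q delta (basisv i) = 1 - \sum_j (Q j i)%:Z.
  rewrite defect_basis d1; congr (_ - _).
  by apply: eq_bigr => j _; rewrite d1 mulr1.
have out i : \sum_j (Q i j)%:Z = 1 + defect Q delta (basisv i).
  have := sum_degrees i; rewrite deg2 db.
  by set a := \sum_j _; set b := \sum_j _; lia.
have inn i : \sum_j (Q j i)%:Z = 1 - defect Q delta (basisv i) by rewrite db; ring.
have bE i : basisv i v - basisv i w = (i == v)%:Z - (i == w)%:Z.
  by rewrite !ffunE ![_ == i]eq_sym.
have vwb : v != w by apply/eqP.
case: dd => dd; [left|right]; split; rewrite // 1?eq_sym // => i;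
  rewrite ?out ?inn; have := dd (basisv i); rewrite bE => e; lia.
Qed.

Lemma three_leaves_no_difference N E v w : underlying_graph Q N E ->
  three_leaves N E -> difference_is_defect Q delta v w -> False.
Proof.
move=> uQ [wf [L [uL sL bL lL]]] dd.
have [f [[g fg gf] deg]] := underlying_degree uQ wf.
have vw i : (\sum_j (Q i j + Q j i) = 1)%N -> i \in [:: v; w].
  move/leaf_defect; rewrite !inE.
  have := dd; rewrite /difference_is_defect => -[] /(_ (basisv i));
  by rewrite !ffunE ![_ == i]eq_sym; case: (i == v); case: (i == w); lia.
(* The value [f v] is a mere default: all labels in [L] are in range. *)
pose h a := g (insubd (f v) a).
have hL a : a \in L -> f (h a) = a :> nat.
  by move=> aL; rewrite /h gf; apply: (insubdK (f v)); exact: (allP bL).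
have hv a : a \in L -> h a \in [:: v; w].
  move=> aL; apply: vw; rewrite deg hL //; apply/eqP.
  exact: (allP lL).
have := uniq_leq_size (s1 := map h L) (s2 := [:: v; w]).
rewrite size_map sL map_inj_in_uniq => [|a b aL bL' hab]; last first.
  by rewrite -(hL a aL) -(hL b bL') hab.
move=> /(_ uL) h3; have : (3 <= 2)%N by apply: h3 => _ /mapP[a aL ->]; exact: hv.
by [].
Qed.

End NullRoot.

(** * Finiteness, the diagonal and the final statement *)

Lemma finite_bounded_ffun (T : finType) :
  finite_set [set c : {ffun T -> int} | forall r, `|c r| <= 1].
Proof.
pose F (g : {ffun T -> 'I_3}) : {ffun T -> int} := [ffun r => (g r)%:Z - 1].
apply: (@sub_finite_set _ _ (F @` setT)) => [c c1|]; last first.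
  by apply: finite_image; exact: finite_finset.
exists [ffun r => inord (absz (c r + 1))] => //; apply/ffunP => r.
by rewrite !ffunE; have := c1 r => cr; rewrite inordK; lia.
Qed.

Section Strata.

Variables (T : finType) (Q : quiver T).

Lemma cvectors_basisv (j : T) : cvectors Q (basisv j).
Proof.
exists [::], j; apply/ffunP => r; rewrite !ffunE /=.
by case: (r == j).
Qed.

Lemma not_filled_diagonal (v w : T) :
  (forall c, cvectors Q c -> c v = c w -> `|c v| <= 1) -> ~ filled Q v w 0.
Proof.
move=> bnd /(_ (2, 2)) []; first by rewrite /= subrr.
by move=> c cQ [cv cw]; have := bnd c cQ; rewrite cv cw => /(_ erefl).
Qed.

(** Since a c-vector exists, every width bound is nonnegative. *)
Lemma diagonal_band_line (v w : T) : band_line Q v w 0.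
Proof.
move=> b /(_ _ (cvectors_basisv v)) h; rewrite normr0.
exact: le_trans (normr_ge0 _) h.
Qed.

End Strata.

Theorem theorem7p3 (T : finType) (Q : quiver T) (delta : {ffun T -> int})
    (null_delta : is_null_root Q delta) :
  (acyclic_quiver Q -> affine_type Q ->
    forall v w : T, banded delta v w -> difference_is_defect Q delta v w ->
    [/\ ~ fills Q v w,
        ~ filled Q v w 0,
        [set x : {ffun T -> int} | x v - x w = 0]
          = [set x | defect Q delta x = 0],
        cvectors Q `&` [set c : {ffun T -> int} | c v - c w = 0]
          = regular_stratum Q delta &
        finite_set (regular_stratum Q delta)]) /\
  (forall (n : nat) (s t : T), (1 <= n)%N -> source_sink_cycle n Q s t ->
    (forall x : {ffun T -> int}, defect Q delta x = x s - x t) /\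
    (forall v w : T, banded delta v w /\ difference_is_defect Q delta v w <->
       (v, w) = (s, t) \/ (v, w) = (t, s)) /\
    (forall c : {ffun T -> int}, cvectors Q c ->
       [\/ defect Q delta c = -1, defect Q delta c = 0
         | defect Q delta c = 1]) /\
    is_width Q s t 1 /\
    band Q s t = [set p : int * int | `|p.1 - p.2| <= 1] /\
    (forall d, band_line Q s t d <-> [\/ d = -1, d = 0 | d = 1]) /\
    cvectors Q `&` [set c : {ffun T -> int} | c s - c t = -1]
      = preprojective_stratum Q delta /\
    cvectors Q `&` [set c : {ffun T -> int} | c s - c t = 0]
      = regular_stratum Q delta /\
    cvectors Q `&` [set c : {ffun T -> int} | c s - c t = 1]
      = preinjective_stratum Q delta /\
    (forall d, band_line Q s t d -> (~ filled Q s t d <-> d = 0))).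
Proof.
split=> [acyQ [N [E [eucE uQ]]] v w [vw _] dd|n s t _ ssc].
  have diag (x : {ffun T -> int}) : x v - x w = 0 <-> defect Q delta x = 0.
    by case: dd => -> ; split=> e; lia.
  have deg2 : forall i, (\sum_j (Q i j + Q j i) = 2)%N.
    case: (euclidean_cases eucE) => [[n [n1 eN eE]]|tl]; last first.
      by case: (three_leaves_no_difference null_delta uQ tl dd).
    rewrite eN eE in uQ.
    have [f [_ deg] i] := underlying_degree uQ (cycle_edges_wf n).
    by rewrite deg cycle_edges_degree.
  have bnd c : cvectors Q c -> c v = c w -> forall r, `|c r| <= 1.
    move=> cQ cvw r.
    have [degs|degs] := difference_is_defect_degrees null_delta vw deg2 dd.
      exact: (cvectors_regular degs r cQ).
    by apply: (cvectors_regular degs r cQ).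
  have nf : ~ filled Q v w 0.
    by apply: not_filled_diagonal => c cQ cvw; exact: bnd.
  split=> //.
  - by move=> h; apply: nf; apply: h; exact: diagonal_band_line.
  - by apply/seteqP; split=> x /= /diag.
  - by apply/seteqP; split=> x /= [xQ /diag e]; split.
  - apply: sub_finite_set (finite_bounded_ffun T) => c [cQ /diag/subr0_eq cvw].
    exact: bnd.
have [uQ acyQ src snk] := ssc.
have deg2 i : (\sum_j (Q i j + Q j i) = 2)%N.
  have [f [_ deg]] := underlying_degree uQ (cycle_edges_wf n).
  by rewrite deg cycle_edges_degree.
have d1 := null_root_eq1 null_delta deg2.
(* Away from [s] and [t] the in- and out-degrees are positive with sum two, so both are one. *)
have degs : source_sink_degrees Q s t.
  have ins : (\sum_j Q j s = 0)%N by rewrite big1 // => j _; apply: (src s).2.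
  have outt : (\sum_j Q t j = 0)%N by rewrite big1 // => j _; apply: (snk t).2.
  have in0 i : i != s -> (0 < \sum_j Q j i)%N.
    move=> is_; rewrite lt0n; apply: contra is_ => /eqP/eqP.
    rewrite sum_nat_eq0 => /forallP h; apply/eqP/src => j.
    exact/eqP/h.
  have out0 i : i != t -> (0 < \sum_j Q i j)%N.
    move=> it_; rewrite lt0n; apply: contra it_ => /eqP/eqP.
    rewrite sum_nat_eq0 => /forallP h; apply/eqP/snk => j.
    exact/eqP/h.
  have st : s != t.
    apply/eqP => st; have := deg2 s.
    by rewrite big_split /= ins {1}st outt.
  have Z (F : T -> nat) : \sum_j (F j)%:Z = (\sum_j F j)%N%:Z.
    by rewrite (big_morph Posz PoszD (erefl _)).
  have deg i := deg2 i; split=> // i; rewrite Z; move: (deg i); rewrite big_split /=.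
  - have [->|is_] := eqVneq i s; first by rewrite ins (negPf st); lia.
    have [->|it_] := eqVneq i t; first by rewrite outt.
    by have := in0 i is_; have := out0 i it_; lia.
  - have [->|is_] := eqVneq i s; first by rewrite ins (negPf st).
    have [->|it_] := eqVneq i t; first by rewrite outt; lia.
    by have := in0 i is_; have := out0 i it_; lia.
have [st _ _] := degs.
have dE (x : {ffun T -> int}) : defect Q delta x = x s - x t.
  rewrite /defect -efE (@eq_ef _ _ _ _ delta (fun=> 1) x x) //.
  by rewrite (ef_constl _ (sum_ahd degs)) mul1r.
have cv3 c : cvectors Q c -> [\/ c s - c t = -1, c s - c t = 0 | c s - c t = 1].
  move=> /(cvectors_diff degs) h.
  have : c s - c t = -1 \/ c s - c t = 0 \/ c s - c t = 1 by lia.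
  by case=> [e|[e|e]]; [constructor 1|constructor 2|constructor 3].
(* The width 1 is attained at the unit vector of [s]. *)
have wid : is_width Q s t 1.
  split=> [c /(cvectors_diff degs)//|b /(_ _ (cvectors_basisv Q s))].
  by rewrite !ffunE eqxx eq_sym (negPf st).
have bl d : band_line Q s t d <-> `|d| <= 1.
  split=> [h|h b /wid.2]; first by apply: h; exact: wid.1.
  exact: le_trans.
have bl3 d : band_line Q s t d <-> [\/ d = -1, d = 0 | d = 1].
  rewrite bl; split=> [h|[] ->] //.
  have : d = -1 \/ d = 0 \/ d = 1 by lia.
  by case=> [e|[e|e]]; [constructor 1|constructor 2|constructor 3].
have nf : ~ filled Q s t 0.
  by apply: not_filled_diagonal => c cQ cst; exact: (cvectors_regular degs s cQ).
split=> //; split=> [v w|].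
  split=> [[[vw _] dd]|].
    (* Evaluation at the unit vectors of [v] and [w] identifies the pair. *)
    have /negPf wv : w != v by rewrite eq_sym; apply/eqP.
    have vw' : (v == w) = false by rewrite eq_sym.
    case: dd => dd; [left|right]; have := dd (basisv v); have := dd (basisv w);
      rewrite !dE !ffunE !eqxx wv vw';
      case: (s =P v) => sv; case: (t =P v) => tv; case: (s =P w) => sw;
      case: (t =P w) => tw e1 e2;
      first [by exfalso; lia | by rewrite sv tw | by rewrite sw tv].
  by move=> [] [-> ->]; split; [split; [exact/eqP|by rewrite !d1]|left=> x; rewrite dE|
    split; [by apply/eqP; rewrite eq_sym|by rewrite !d1]|right=> x; rewrite dE; ring].
split=> [c cQ|]; first by rewrite dE; exact: cv3.
split=> //; split.
  by apply/seteqP; split=> p /=; [exact: (bl _).1|exact: (bl _).2].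
split=> //; split.
  apply/seteqP; split=> c /= [cQ e]; split=> //; first by rewrite dE e.
  by move: e; rewrite dE; case: (cv3 c cQ); lia.
split.
  by apply/seteqP; split=> c /= [cQ e]; split=> //; move: e; rewrite dE.
split.
  apply/seteqP; split=> c /= [cQ e]; split=> //; first by rewrite dE e.
  by move: e; rewrite dE; case: (cv3 c cQ); lia.
move=> d /bl3 d3; split=> [h|-> //].
case: d3 => // d3; case: h; apply: (filled_pm1 degs); [by right|by left].
Qed.
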